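(* Let $d\ge1$, $q\in(0,1)$, and consider the discrete-time multi-hop model on the entire lattice $\mathbb{Z}^d$ described in the context, with service algorithm (D1) or (D2), where the exogenous arrivals are i.i.d. copies of $\xi$ with $\mathbb{E}(\xi)=\lambda q$ and $\mathbb{E}(\xi^2)<\infty$. Assume $\lambda<\frac{1}{2d+1}$. Then the process is stable. Moreover, there is a translation-invariant stationary distribution for which $$\mathbb{E}X\ \le\ \frac{\mathbb{E}(\xi^2)+2d(1-q)\lambda+\lambda-2\lambda^2q^2}{2q\left(\frac{1}{2d+1}-\lambda\right)},$$ where $X$ has the distribution of $X_i(k)$ (for any $i$ and $k$) in steady state.
   Context: Nodes are the points of $\mathbb{Z}^d$; two nodes are adjacent if they are connected by one lattice edge. $\mathcal{N}_i$ is the set consisting of $i$ and its $2d$ adjacent nodes. The service rates are $\psi_i(\bar x)=x_i/\sum_{j\in\mathcal{N}_i}x_j$, with $0/0:=0$. Dynamics. The state $\bar X(k)\in\mathbb{Z}_+^{\mathbb{Z}^d}$ evolves as $$X_i(k+1)=X_i(k)+\xi_i(k)+\sum_{j\in\mathcal{N}_i,\,j\ne i}I_{ji}(k)\eta_j(k)-\eta_i(k).$$ The exogenous arrivals $\xi_i(k)$ are $\mathbb{Z}_+$-valued and i.i.d. over $i$ and $k$, distributed as $\xi$. $\eta_i(k)\in\{0,1\}$ indicates a service completion at node $i$ in slot $k$. After a service completion at node $j$ the job leaves the system with probability $q$, or moves to an adjacent node $i$, each chosen with probability $(1-q)/(2d)$; $I_{ji}(k)$ indicates the choice of destination $i$.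 Routing choices are independent over nodes and slots and of everything else. Services. They are driven by $U_i(k)$, i.i.d. over $i,k$, uniform on $[0,1]$, independent of arrivals and routing, by one of two algorithms: (D1) let $\tau_i(k)=[-\log U_i(k)]/X_i(k)$ ($=\infty$ if $X_i(k)=0$); node $i$ serves a job in slot $k$ iff $X_i(k)>0$ and $\tau_i(k)<\tau_j(k)$ for all $j\in\mathcal{N}_i\setminus\{i\}$; (D2) node $i$ serves a job in slot $k$ iff $X_i(k)>0$ and $U_i(k)<\psi_i(\bar X(k))$. Stability of the infinite network means existence of a proper stationary distribution of $\bar X(\cdot)$ (all queues finite with probability 1). *)

(* Defs.v *)
From HB Require Import structures.
From mathcomp Require Import all_boot all_order all_algebra.
From mathcomp Require Import all_classical all_reals all_analysis.

Set Implicit Arguments.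
Unset Strict Implicit.
Unset Printing Implicit Defensive.
Import Order.TTheory GRing.Theory Num.Theory.

Local Open Scope classical_set_scope.
Local Open Scope ring_scope.

Definition node (d : nat) := 'rV[int]_d.

Definition unit_steps (d : nat) : seq (node d) :=
  [seq delta_mx 0 a | a <- enum 'I_d] ++ [seq - delta_mx 0 a | a <- enum 'I_d].

(* The 2d nodes adjacent to i, without repetition; N_i is i :: nbrs i. *)
Definition nbrs (d : nat) (i : node d) : seq (node d) :=
  [seq i + e | e <- unit_steps d].

Definition cylinders (d : nat) : set (set (node d -> nat)) :=
  [set A | exists i n, A = [set x | x i = n]].

(* Z_+^(Z^d) with the product sigma-algebra. All queues are finite by typing,
   so every probability on this space is proper. *)
Definition state (d : nat) := g_sigma_algebraType (@cylinders d).

(* Destination of a job completing service: None means that it leaves. *)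
Definition destination (d : nat) := option (node d).

HB.instance Definition _ (d : nat) := Choice.on (destination d).
HB.instance Definition _ (d : nat) := isPointed.Build (destination d) None.
HB.instance Definition _ (d : nat) :=
  @isMeasurable.Build default_measure_display (destination d)
    discrete_measurable discrete_measurable0
    (@discrete_measurableC _) (@discrete_measurableU _).

Inductive algorithm := D1 | D2.

Section dynamics.
Context {R : realType} {d : nat}.
Implicit Types (x : state d) (u : node d -> R) (i : node d).

(* [lne 0 = -oo], so that tau is infinite when u i = 0. *)
Definition tau x u i : \bar R :=
  if x i == 0%N then +oo%E else (- lne (u i)%:E * ((x i)%:R^-1)%:E)%E.

(* MathComp's inverse satisfies 0 / 0 = 0. *)
Definition psi x i : R := (x i)%:R / (\sum_(j <- i :: nbrs i) x j)%N%:R.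

Definition eta (alg : algorithm) x u i : bool :=
  (0 < x i)%N &&
  match alg with
  | D1 => all (fun j => (tau x u i < tau x u j)%E) (nbrs i)
  | D2 => u i < psi x i
  end.

(* No truncation occurs in the subtraction: eta is 0 at an empty node. *)
Definition step (alg : algorithm) x (a : node d -> nat) u
    (r : node d -> destination d) : state d :=
  fun i => (x i + a i + \sum_(j <- nbrs i) (r j == Some i) * eta alg x u j
            - eta alg x u i)%N.

Fixpoint queues (alg : algorithm) (a : nat -> node d -> nat)
    (u : nat -> node d -> R) (r : nat -> node d -> destination d) (x : state d)
    (k : nat) : state d :=
  if k is k'.+1 then step alg (queues alg a u r x k') (a k') (u k') (r k')
  else x.

End dynamics.

Section drivers.
Context {R : realType} {d : nat} {dO : measure_display}
  {Omega : measurableType dO} (P : probability Omega R).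

Definition mutually_independent (I : eqType) (F : I -> set (set Omega)) :=
  forall (s : seq I) (A : I -> set Omega), uniq s ->
    (forall i, i \in s -> F i (A i)) ->
    P (\bigcap_(i in [set` s]) A i) = (\prod_(i <- s) P (A i))%E.

(* The sigma-algebra generated by a random variable. *)
Definition sigma_of {dT : measure_display} {T : measurableType dT}
    (Y : {RV P >-> T}) : set (set Omega) :=
  preimage_set_system setT Y measurable.

Variables (xi : nat -> node d -> {RV P >-> nat})
  (U : nat -> node d -> {RV P >-> R})
  (r : nat -> node d -> {RV P >-> destination d}).

Definition driver_sigma
    (l : nat * node d + nat * node d + nat * node d) : set (set Omega) :=
  match l with
  | inl (inl (k, i)) => sigma_of (xi k i)
  | inl (inr (k, i)) => sigma_of (U k i)
  | inr (k, i) => sigma_of (r k i)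
  end.

Definition network_drivers (law_xi : probability nat R) (q : R) : Prop :=
  [/\ forall k i (A : set nat), distribution P (xi k i) A = law_xi A,
      forall k i (B : set R), measurable B ->
        distribution P (U k i) B = uniform_prob (@ltr01 R) B,
      forall k j, distribution P (r k j) [set None] = q%:E /\
        forall i, i \in nbrs j ->
          distribution P (r k j) [set Some i] = ((1 - q) / (2 * d%:R))%:E &
      mutually_independent driver_sigma].

(* Queue lengths in slot k on the product space carrying the initial state
   w.1 and, independently of it, the drivers evaluated at w.2. *)
Definition Xproc (alg : algorithm) (k : nat) (w : state d * Omega) : state d :=
  queues alg (fun k i => xi k i w.2) (fun k i => U k i w.2)
    (fun k i => r k i w.2) w.1 k.

Definition stationary (alg : algorithm) (pi : probability (state d) R) : Prop :=
  forall k (A : set (state d)), measurable A ->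
    pushforward (pi \x P)%E (Xproc alg k) A = pi A.

Definition stable (alg : algorithm) : Prop :=
  exists pi : probability (state d) R, stationary alg pi.

End drivers.

Definition translate (d : nat) (v : node d) (x : state d) : state d :=
  fun i => x (i + v).

Definition translation_invariant (R : realType) (d : nat)
    (pi : probability (state d) R) : Prop :=
  forall (v : node d) (A : set (state d)), measurable A ->
    pushforward pi (translate v) A = pi A.

(* Main.v *)
(** The laws of the queues started from the empty network are translation
    invariant, and under (D1) as under (D2) node [i] is served with conditional
    probability [psi_i].  Write [S_i] for the number of jobs in [N_i] and
    [c = 1/(2d+1)].  Exchanging the roles of neighbouring nodes turns the drift
    of [E X_i^2] into a multiple of [E X_i - E X_i^2/S_i], and
    [x^2/S >= 2 c x - c^2 S] bounds it by [- 2 q (c - lambda) E X_i] plus terms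
    in [E psi_i], whose time average is at most [lambda] because at most as many
    jobs leave the network as enter it.  Summing over time, the time averages of
    the laws have means below the claimed bound.

    By Markov's inequality no mass escapes, so along a subsequence the time
    averages converge on all events that depend on finitely many nodes, to a
    probability built from nested intervals of [[0, 1)].  Such events pull back
    to such events under one step with fixed drivers, so dominated convergence
    over the drivers shows that the limit is stationary; translation invariance
    and the bound on the mean pass to the limit. *)

From HB Require Import structures.
Require Import Defs.
From mathcomp Require Import all_boot all_order all_algebra.
From mathcomp Require Import all_classical all_reals all_analysis.
From mathcomp Require Import measurable_realfun lra ring zify.

Set Implicit Arguments.
Unset Strict Implicit.
Unset Printing Implicit Defensive.
Import Order.TTheory GRing.Theory Num.Theory.
Import numFieldNormedType.Exports.

Local Open Scope classical_set_scope.
Local Open Scope ring_scope.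

(** * Independence of groups of sigma-algebras *)

(** Stationarity speaks of a whole sequence of drivers on an arbitrary space. Independence of slot
    [k] from the earlier slots reduces it to invariance under one kernel, [transition], which
    depends only on the law of the drivers of a single slot; most of the measure theory serves this
    reduction.

    The drift inequality needs a finite second moment to subtract, and a stationary law is not known
    to have one. It is therefore used only along the chain started empty, where each slot has a
    finite second moment, and just the bound on the mean survives the limit.

    Exchanging neighbours is what makes the drift computable. Inflow contributes [x_i psi_j], which
    nothing bounds locally, whereas the exchanged sum of [x_j psi_i] over [N_i] is exactly [x_i],
    because [psi_i] carries the total of [N_i] as denominator. *)

Section independence.
Context {R : realType} {dO : measure_display} {Omega : measurableType dO}.
Implicit Type P : probability Omega R.

Lemma probability_unique (P1 P2 : probability Omega R) (C : set (set Omega)) :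
  C `<=` measurable -> setI_closed C -> C setT ->
  (forall A, C A -> P1 A = P2 A) -> forall A, <<s C >> A -> P1 A = P2 A.
Proof.
move=> Cm CI CT CE A CA.
apply: (g_sigma_algebra_measure_unique C Cm (fun=> setT)) => //.
- by rewrite bigcup_const//; exists 0%N.
- by move=> _; rewrite (le_lt_trans (probability_le1 _ _)) ?ltry.
Qed.

(** As functions of [A] both sides are finite measures, [P] restricted to [B] and [P] scaled by the
    number [P B], so agreement on a generating pi-system suffices. *)
Lemma indep_generated_l P (C : set (set Omega)) (B : set Omega) :
  C `<=` measurable -> setI_closed C -> C setT -> measurable B ->
  (forall A, C A -> P (A `&` B) = (P A * P B)%E) ->
  forall A, <<s C >> A -> P (A `&` B) = (P A * P B)%E.
Proof.
move=> Cm CI CT mB CE A CA.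
have p0 : 0 <= fine (P B) by exact: fine_ge0.
pose m2 := mscale (NngNum p0) P.
have m2E D : m2 D = (P D * P B)%E.
  by rewrite /m2 /mscale /= muleC fineK// fin_num_measure.
rewrite -m2E -[LHS]/(mrestr P mB A).
apply: (g_sigma_algebra_measure_unique C Cm (fun=> setT)) => //.
- by rewrite bigcup_const//; exists 0%N.
- by move=> D CD; rewrite [RHS](m2E D); exact: CE.
- by move=> _; rewrite /mrestr (le_lt_trans (probability_le1 _ _)) ?ltry// setTI.
Qed.

Lemma indep_generated P (C1 C2 : set (set Omega)) :
  C1 `<=` measurable -> setI_closed C1 -> C1 setT ->
  C2 `<=` measurable -> setI_closed C2 -> C2 setT ->
  (forall A B, C1 A -> C2 B -> P (A `&` B) = (P A * P B)%E) ->
  forall A B, <<s C1 >> A -> <<s C2 >> B -> P (A `&` B) = (P A * P B)%E.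
Proof.
move=> C1m C1I C1T C2m C2I C2T CE A B CA CB.
have sub2 : <<s C2 >> `<=` measurable.
  by apply: smallest_sub => //; exact: sigma_algebra_measurable.
apply: (indep_generated_l C1m) => //; first exact: sub2.
move=> {CA} {}A CA; rewrite setIC muleC.
apply: (indep_generated_l C2m) => //; first exact: C1m.
by move=> {CB} {}B CB; rewrite setIC muleC CE.
Qed.

Section groups.
Variables (I : eqType) (F : I -> set (set Omega)).
Hypothesis Fm : forall i, F i `<=` measurable.
Hypothesis FI : forall i, setI_closed (F i).
Hypothesis FT : forall i, F i setT.

Definition group_sets (D : set I) : set (set Omega) :=
  <<s \bigcup_(i in D) F i >>.

(** The union of the [F i] is not closed under intersection across different indices. Finite
    intersections are, they generate the same sigma-algebra, and mutual independence gives their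
    probabilities. *)
Definition finite_meets (D : set I) : set (set Omega) :=
  [set A | exists (s : seq I) (B : I -> set Omega),
    [/\ uniq s, [set` s] `<=` D, forall i, i \in s -> F i (B i) &
        A = \bigcap_(i in [set` s]) B i]].

Lemma finite_meets_measurable D : finite_meets D `<=` measurable.
Proof.
move=> A [s [B [_ _ sB ->]]]; apply: fin_bigcap_measurable => //.
by move=> i si; apply/(@Fm i)/sB.
Qed.

Lemma finite_meetsT D : finite_meets D setT.
Proof. by exists [::], (fun=> setT); split => //; rewrite set_nil bigcap_set0. Qed.

Lemma finite_meetsI D : setI_closed (finite_meets D).
Proof.
move=> A1 A2 [s1 [B1 [u1 D1 F1 ->]]] [s2 [B2 [u2 D2 F2 ->]]].
exists (undup (s1 ++ s2)), (fun i => (if i \in s1 then B1 i else setT) `&`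
  (if i \in s2 then B2 i else setT)); split.
- exact: undup_uniq.
- move=> i /=; rewrite mem_undup mem_cat => /orP[?|?]; [exact: D1|exact: D2].
- by move=> i _; apply: FI; case: ifPn => // ?; [exact: F1|exact: F2].
- apply/seteqP; split=> w.
    by move=> [h1 h2] i /= _; split; case: ifPn => // ?; [exact: h1|exact: h2].
  move=> h; split=> i /= si; have := h i; rewrite /= mem_undup mem_cat si ?orbT;
  by move=> /(_ isT)[].
Qed.

Lemma group_sets_finite_meets D : group_sets D = <<s finite_meets D >>.
Proof.
apply/seteqP; split.
  apply: sub_sigma_algebra2 => A [i Di FA].
  exists [:: i], (fun=> A); split => //.
  - by move=> j; rewrite /= inE => /eqP ->.
  - by move=> j; rewrite /= inE => /eqP ->.
  - by apply/seteqP; split=> [w ? j //|w /(_ i)]; apply; rewrite /= inE.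
apply: smallest_sub; first exact: smallest_sigma_algebra.
move=> A [s [B [_ sD sB ->]]].
apply: (@fin_bigcap_measurable _ (g_sigma_algebraType (\bigcup_(i in D) F i))) => //.
by move=> i si; apply: sub_sigma_algebra; exists i; [exact: sD|exact: sB].
Qed.

Lemma independent_groups P (D1 D2 : set I) : mutually_independent P F ->
  D1 `&` D2 = set0 -> forall A B, group_sets D1 A -> group_sets D2 B ->
  P (A `&` B) = (P A * P B)%E.
Proof.
move=> Pind D12; rewrite !group_sets_finite_meets => A B.
apply: indep_generated; [exact: finite_meets_measurable|exact: finite_meetsI|
  exact: finite_meetsT|exact: finite_meets_measurable|exact: finite_meetsI|
  exact: finite_meetsT|].
move=> {A B} _ _ [s1 [B1 [u1 sD1 F1 ->]]] [s2 [B2 [u2 sD2 F2 ->]]].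
have s12 i : i \in s2 -> i \notin s1.
  move=> is2; apply/negP => is1; have : (D1 `&` D2) i by split; [exact: sD1|exact: sD2].
  by rewrite D12.
(* Disjointness of the index sets merges the two families into one over [s1 ++ s2], to which mutual
   independence applies directly. *)
pose B i := if i \in s1 then B1 i else B2 i.
have -> : \bigcap_(i in [set` s1]) B1 i `&` \bigcap_(i in [set` s2]) B2 i =
    \bigcap_(i in [set` s1 ++ s2]) B i.
  apply/seteqP; split=> [w [h1 h2] i /=|w h].
    rewrite mem_cat /B; case: ifPn => [? _|_ /=]; [exact: h1|exact: h2].
  split=> i /= si; have := h i; rewrite /= mem_cat si ?orbT => /(_ isT).
    by rewrite /B si.
  by rewrite /B ifN// s12.
rewrite Pind; last 2 first.
- rewrite cat_uniq u1 u2 andbT; apply/hasPn => i; exact: s12.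
- move=> i; rewrite mem_cat /B; case: ifPn => [? _|_ /=]; [exact: F1|exact: F2].
rewrite (Pind _ _ u1 F1) (Pind _ _ u2 F2) big_cat/=; congr (_ * _)%E.
  by apply: eq_big_seq => i ?; rewrite /B ifT.
by apply: eq_big_seq => i ?; rewrite /B ifN// s12.
Qed.

Lemma law_unique P1 P2 : mutually_independent P1 F -> mutually_independent P2 F ->
  (forall i A, F i A -> P1 A = P2 A) ->
  forall A, group_sets setT A -> P1 A = P2 A.
Proof.
move=> ind1 ind2 FE A; rewrite group_sets_finite_meets.
apply: probability_unique; [exact: finite_meets_measurable|exact: finite_meetsI|
  exact: finite_meetsT|].
move=> {A} _ [s [B [us _ sB ->]]]; rewrite ind1// ind2//.
by apply: eq_big_seq => i si; apply: FE; exact: sB.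
Qed.

End groups.
End independence.

Lemma preimage_sigmaI {S : Type} {dT} {T : measurableType dT} (Y : S -> T) :
  setI_closed (preimage_set_system setT Y measurable).
Proof.
move=> _ _ [A mA <-] [B mB <-]; exists (A `&` B); first exact: measurableI.
by rewrite !setTI preimage_setI.
Qed.

Lemma preimage_sigmaT {S : Type} {dT} {T : measurableType dT} (Y : S -> T) :
  preimage_set_system setT Y measurable setT.
Proof. by exists setT => //; rewrite setTI preimage_setT. Qed.

(** * Measurability of one step *)

Section discrete_measurability.
Context {dW} {W : measurableType dW} {dT} {T : measurableType dT}.

(** The values of [f] cut the space into countably many measurable pieces. This lets case
    distinctions and divisions on queue lengths be treated with the length frozen. *)
Lemma measurable_fun_glue (f : W -> nat) (g : nat -> W -> T) :
  measurable_fun setT f -> (forall n, measurable_fun setT (g n)) ->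
  measurable_fun setT (fun w => g (f w) w).
Proof.
move=> mf mg _ B mB; rewrite setTI.
have -> : (fun w => g (f w) w) @^-1` B =
    \bigcup_n (f @^-1` [set n] `&` g n @^-1` B).
  apply/seteqP; split=> [w Bw|w [n _ [/= <-]]//]; by exists (f w).
apply: bigcupT_measurable => n; apply: measurableI; rewrite -[X in measurable X]setTI.
  exact: mf.
exact: mg.
Qed.

Lemma measurable_fun_nat (f : W -> nat) (h : nat -> T) :
  measurable_fun setT f -> measurable_fun setT (fun w => h (f w)).
Proof. by move=> mf; apply: (measurable_fun_glue (g := fun n _ => h n)). Qed.

End discrete_measurability.

Lemma measurable_fun_nat2 {dW} {W : measurableType dW} {dT} {T : measurableType dT}
    (f g : W -> nat) (h : nat -> nat -> T) :
  measurable_fun setT f -> measurable_fun setT g ->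
  measurable_fun setT (fun w => h (f w) (g w)).
Proof.
move=> mf mg; apply: (measurable_fun_glue (g := fun n w => h n (g w))) => // n.
exact: measurable_fun_nat.
Qed.

Lemma measurable_fun_sumn {dW} {W : measurableType dW} (I : Type) (s : seq I)
    (f : I -> W -> nat) : (forall i, measurable_fun setT (f i)) ->
  measurable_fun setT (fun w => \sum_(i <- s) f i w)%N.
Proof.
move=> mf; elim: s => [|i s IH].
  rewrite (_ : (fun _ => _) = cst 0%N); first exact: measurable_cst.
  by apply/funext => w; rewrite big_nil.
rewrite (_ : (fun _ => _) = fun w => f i w + \sum_(j <- s) f j w)%N; last first.
  by apply/funext => w; rewrite big_cons.
exact: (measurable_fun_nat2 addn).
Qed.

Section into_generated.
Context {dW} {W : measurableType dW} {T : pointedType} (G : set (set T)).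

Lemma measurable_fun_generated (f : W -> g_sigma_algebraType G) :
  (forall A, G A -> measurable (f @^-1` A)) -> measurable_fun setT f.
Proof.
move=> mf; apply: (@measurability _ _ W (g_sigma_algebraType G) setT f G erefl).
by move=> _ [A GA <-]; rewrite setTI; exact: mf.
Qed.

End into_generated.

Section state_measurability.
Context {d : nat} {dW : measure_display} {W : measurableType dW}.

Lemma measurable_stateP (X : W -> state d) :
  (forall i, measurable_fun setT (fun w => X w i)) <-> measurable_fun setT X.
Proof.
split=> mX.
  apply: measurable_fun_generated => A [i [n ->]]; rewrite -[X in measurable X]setTI.
  exact: (mX i _ [set n]).
move=> i _ B mB; rewrite setTI.
have -> : (fun w => X w i) @^-1` B = \bigcup_(n in B) X @^-1` [set x : state d | x i = n].
  apply/seteqP; split=> [w Bw|w [n Bn /= Xn]]; [by exists (X w i)|by rewrite /= Xn].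
apply: bigcup_measurable => n _; rewrite -[X in measurable X]setTI.
by apply: mX => //; apply: sub_sigma_algebra; exists i, n.
Qed.

End state_measurability.

Definition slot_values (R : realType) (d : nat) : Type :=
  ((node d -> nat) * (node d -> R) * (node d -> destination d))%type.

Section slot.
Context {R : realType} {d : nat}.
Implicit Types (i j v : node d).

HB.instance Definition _ := gen_eqMixin (slot_values R d).
HB.instance Definition _ := gen_choiceMixin (slot_values R d).
HB.instance Definition _ := isPointed.Build (slot_values R d)
  ((fun=> 0%N, fun=> 0), fun=> None).

Definition slot_sigma (l : node d + node d + node d) : set (set (slot_values R d)) :=
  match l with
  | inl (inl i) => preimage_set_system setT (fun e => e.1.1 i) measurable
  | inl (inr i) => preimage_set_system setT (fun e => e.1.2 i) measurable
  | inr i => preimage_set_system setT (fun e => e.2 i) measurable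
  end.

(** The coordinates generate the sigma-algebra, so that the drivers of one slot form a single random
    variable and its law can serve as the noise of a Markov kernel. *)
Definition slot := g_sigma_algebraType (\bigcup_(l in setT) slot_sigma l).

Lemma measurable_slot_arrival i : measurable_fun [set: slot] (fun e : slot => e.1.1 i).
Proof. by move=> _ B mB; apply: sub_sigma_algebra; exists (inl (inl i)) => //; exists B. Qed.

Lemma measurable_slot_uniform i : measurable_fun [set: slot] (fun e : slot => e.1.2 i).
Proof. by move=> _ B mB; apply: sub_sigma_algebra; exists (inl (inr i)) => //; exists B. Qed.

Lemma measurable_slot_route i : measurable_fun [set: slot] (fun e : slot => e.2 i).
Proof. by move=> _ B mB; apply: sub_sigma_algebra; exists (inr i) => //; exists B. Qed.

Lemma measurable_fun_slot {dW} {W : measurableType dW} (Z : W -> slot) :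
  (forall i, measurable_fun setT (fun w => (Z w).1.1 i)) ->
  (forall i, measurable_fun setT (fun w => (Z w).1.2 i)) ->
  (forall i, measurable_fun setT (fun w => (Z w).2 i)) ->
  measurable_fun setT Z.
Proof.
move=> ma mu mr; apply: measurable_fun_generated => _ [[[i|i]|i] _ [B mB <-]];
  rewrite setTI -[X in measurable X]setTI; [exact: ma|exact: mu|exact: mr].
Qed.

End slot.
Arguments slot R d : clear implicits.

Section step_measurability.
Context {R : realType} {d : nat} {dW : measure_display} {W : measurableType dW}.
Variables (X : W -> state d) (u : node d -> W -> R).
Hypotheses (mX : measurable_fun setT X) (mu : forall i, measurable_fun setT (u i)).

Let mXi i : measurable_fun setT (fun w => X w i).
Proof. exact: (measurable_stateP X).2. Qed.

Let u' w i := u i w.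

Lemma measurable_psi i : measurable_fun setT (fun w => psi (X w) i : R).
Proof.
rewrite /psi; apply: (measurable_fun_nat2 (fun m n => m%:R / n%:R : R)) => //.
exact: measurable_fun_sumn.
Qed.

Lemma measurable_tau i : measurable_fun setT (fun w => tau (X w) (u' w) i).
Proof.
rewrite /tau; apply: (measurable_fun_glue (g := fun n w =>
  if n == 0%N then +oo%E else (- lne (u i w)%:E * (n%:R^-1)%:E)%E)) => // n.
case: (n == 0)%N => //; apply: emeasurable_funM => //.
apply: measurableT_comp => //=.
apply: measurable_fun_ifT => //; first exact: measurable_fun_ler.
by apply/measurable_EFinP; apply: measurableT_comp => //; exact: measurable_ln.
Qed.

Lemma measurable_eta alg i : measurable_fun setT (fun w => eta alg (X w) (u' w) i).
Proof.
rewrite /eta; apply: measurable_and.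
  exact: (measurable_fun_nat (fun n => 0 < n)%N).
case: alg; last by apply: measurable_fun_ltr; [exact: mu|exact: measurable_psi].
elim: (nbrs i) => [//|j s IH] /=; apply: measurable_and => //.
by apply: measurable_fun_lte; exact: measurable_tau.
Qed.

End step_measurability.

Definition stepmap {R : realType} {d : nat} (alg : algorithm)
    (w : state d * slot R d) : state d :=
  step alg w.1 w.2.1.1 w.2.1.2 w.2.2.

Section stepmap_measurability.
Context {R : realType} {d : nat}.

Lemma measurable_coord (i : node d) : measurable_fun [set: state d] (fun x : state d => x i).
Proof. exact: (measurable_stateP id).2. Qed.

Lemma measurable_stepmap alg : measurable_fun setT (@stepmap R d alg).
Proof.
have m1 : measurable_fun setT (fun w : state d * slot R d => w.1) by exact: measurable_fst.
have mU i : measurable_fun setT (fun w : state d * slot R d => w.2.1.2 i).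
  by apply: (measurableT_comp (measurable_slot_uniform i)); exact: measurable_snd.
have mA i : measurable_fun setT (fun w : state d * slot R d => w.2.1.1 i).
  by apply: (measurableT_comp (measurable_slot_arrival i)); exact: measurable_snd.
have mR i : measurable_fun setT (fun w : state d * slot R d => w.2.2 i).
  by apply: (measurableT_comp (measurable_slot_route i)); exact: measurable_snd.
have meta i : measurable_fun setT (fun w : state d * slot R d => eta alg w.1 w.2.1.2 i : nat).
  apply: (measurableT_comp (f := nat_of_bool)) => //.
  exact: (measurable_eta m1 mU alg i).
apply/measurable_stateP => i; rewrite /stepmap /step.
apply: (measurable_fun_nat2 subn) => //.
apply: (measurable_fun_nat2 addn) => //.
  apply: (measurable_fun_nat2 addn) => //.
  exact: (measurableT_comp (measurable_coord i)).
apply: measurable_fun_sumn => j.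
apply: (measurable_fun_nat2 muln) => //.
by apply: (measurableT_comp (f := fun o : destination d => (o == Some i : nat))).
Qed.

End stepmap_measurability.

(** Destinations are recorded as absolute nodes, so re-indexing the sources is not enough: the
    target of each job must be moved by [- v] as well. *)
Definition slot_shift {R : realType} {d : nat} (v : node d) (e : slot R d) : slot R d :=
  ((fun i => e.1.1 (i + v), fun i => e.1.2 (i + v)),
   fun i => omap (fun z => z - v) (e.2 (i + v))).

Section translation.
Context {R : realType} {d : nat}.
Implicit Types (i j v : node d) (x : state d) (u : node d -> R).

Lemma nbrs_shift i v : nbrs (i + v) = [seq j + v | j <- nbrs i].
Proof. by rewrite /nbrs -map_comp; apply: eq_map => e /=; rewrite addrAC. Qed.

Lemma psi_shift x i v : psi (translate v x) i = psi x (i + v) :> R.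
Proof. by rewrite /psi nbrs_shift !big_cons [in RHS]big_map. Qed.

Lemma eta_shift alg x u i v :
  eta alg (translate v x) (fun j => u (j + v)) i = eta alg x u (i + v).
Proof.
rewrite /eta; congr (_ && _); case: alg; last by rewrite psi_shift.
by rewrite nbrs_shift [in RHS]all_map.
Qed.

Lemma stepmap_shift alg x (e : slot R d) v :
  stepmap alg (translate v x, slot_shift v e) = translate v (stepmap alg (x, e)).
Proof.
apply/funext => i; rewrite /stepmap /step /translate /= nbrs_shift (big_map (fun j => j + v)).
rewrite -!(eta_shift _ x); congr (_ + _ - _)%N.
apply: eq_bigr => j _; rewrite eta_shift; congr (nat_of_bool _ * _)%N.
case: (e.2 (j + v)) => [z|] //=.
by rewrite !(inj_eq Some_inj) subr_eq.
Qed.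

Lemma measurable_slot_shift v : measurable_fun setT (@slot_shift R d v).
Proof.
apply: measurable_fun_slot => i; [exact: measurable_slot_arrival|
  exact: measurable_slot_uniform|].
pose g (o : destination d) : destination d := omap (fun z => z - v) o.
have mg : measurable_fun setT g by [].
exact: (measurableT_comp mg (measurable_slot_route _)).
Qed.

Lemma measurable_translate v : measurable_fun setT (@translate d v).
Proof. by apply/measurable_stateP => i; exact: measurable_coord. Qed.

End translation.

(** * The law of the drivers of one slot *)

Definition measurable_map {d1 d2} {T1 : measurableType d1} {T2 : measurableType d2}
    (f : T1 -> T2) (mf : measurable_fun setT f) : {mfun T1 >-> T2} :=
  HB.pack f (isMeasurableFun.Build _ _ _ _ f mf).

Section law.
Context {d1 d2} {T1 : measurableType d1} {T2 : measurableType d2} {R : realType}.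

(** The measurability proof is an argument, so that the image law is at once a [probability] for any
    map proved measurable. *)
Definition law (P : probability T1 R) (f : T1 -> T2) (mf : measurable_fun setT f) :
  probability T2 R := distribution P (measurable_map mf).

Lemma lawE P f (mf : measurable_fun setT f) A : law P mf A = P (f @^-1` A).
Proof. by []. Qed.

Lemma law_independent (I J : eqType) (F : I -> set (set T1)) (G : J -> set (set T2))
    (idx : J -> I) P f (mf : measurable_fun setT f) : injective idx ->
  (forall j A, G j A -> F (idx j) (f @^-1` A)) ->
  mutually_independent P F -> mutually_independent (law P mf) G.
Proof.
move=> idxI GF ind s A us sA.
(* The family must be re-indexed by [I] without an inverse of [idx]. Intersecting over the fibre
   does this, and injectivity makes each fibre met by [s] a single index. *)
pose B i := \bigcap_(j in [set j | j \in s /\ idx j = i]) f @^-1` (A j).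
have BE j : j \in s -> B (idx j) = f @^-1` (A j).
  move=> js; apply/seteqP; split=> w; first by apply.
  by move=> Aw k [ks /idxI ->].
rewrite lawE preimage_bigcap.
have -> : \bigcap_(j in [set` s]) f @^-1` (A j) = \bigcap_(i in [set` map idx s]) B i.
  apply/seteqP; split=> [w h i /= /mapP[j js ->]|w h j /= js].
    by rewrite BE//; exact: h.
  suff : B (idx j) w by rewrite BE.
  by apply: h => /=; exact: map_f.
rewrite ind ?map_inj_uniq//; last first.
  by move=> _ /mapP[j js ->]; rewrite BE//; exact/GF/sA.
by rewrite big_map; apply: eq_big_seq => j js; rewrite BE.
Qed.

End law.

(** The drivers prescribe the routing law only at [None] and at the adjacent nodes. As these atoms
    already have total mass one, nothing is left elsewhere and the law is determined. *)
Lemma finite_support_unique {R : realType} {dT} {T : measurableType dT}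
    (m1 m2 : probability T R) (s : seq T) :
  (forall t : T, measurable [set t]) -> uniq s ->
  (forall t, t \in s -> m1 [set t] = m2 [set t]) ->
  (\sum_(t <- s) m1 [set t] = 1)%E ->
  forall A, measurable A -> m1 A = m2 A.
Proof.
move=> mT us ms m11.
have mS (s' : seq T) : measurable [set` s'].
  rewrite (_ : [set` s'] = \bigcup_(t in [set` s']) [set t]).
    by apply: fin_bigcup_measurable => // t _; exact: mT.
  by apply/seteqP; split=> [t ?|t [z ? /= ->]//]; exists t.
have sumE (m : probability T R) (D : set T) : measurable D ->
    m (D `&` [set` s]) = (\sum_(t <- s | t \in D) m [set t])%E.
  move=> mD; elim: s us {ms m11} => [_|t s IH /= /andP[ts us]].
    by rewrite set_nil setI0 measure0 big_nil.
  have -> : D `&` [set` t :: s] = (D `&` [set t]) `|` (D `&` [set` s]).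
    rewrite -setIUr; congr (_ `&` _); apply/seteqP; split=> z /=; rewrite inE.
      by move=> /predU1P.
    by move=> ?; apply/predU1P.
  rewrite measureU//; last 3 first.
  - exact: measurableI.
  - exact: measurableI.
  - by rewrite -subset0 => z [[_ /= ->] [_ /=]]; rewrite (negbTE ts).
  rewrite [X in (_ + X)%E](IH us) big_cons; case: ifPn => [/set_mem Dt|tD].
    by rewrite (_ : D `&` [set t] = [set t])//; apply/setIidPr => _ /= ->.
  rewrite (_ : D `&` [set t] = set0) ?measure0 ?add0e//.
  by rewrite -subset0 => z [Dz /= zt]; move: tD; rewrite notin_setE -zt.
have one (m : probability T R) : (\sum_(t <- s) m [set t] = 1)%E ->
    forall D, measurable D -> m D = m (D `&` [set` s]).
  move=> m_1 D mD; have mS1 : m [set` s] = 1%E.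
    rewrite -m_1 -[in LHS](setTI [set` s]) sumE//.
    by apply: eq_bigl => t; rewrite in_setT.
  rewrite -[in LHS](setIT D) -(setvU [set` s]) setIUr measureU//; last 3 first.
  - by apply: measurableI => //; exact: measurableC.
  - exact: measurableI.
  - by rewrite setIACA setICl setI0.
  rewrite [X in (X + _)%E](_ : _ = 0%E) ?add0e//.
  apply/eqP; rewrite -measure_le0 (le_trans (measureIr _ _ _))//; first exact: measurableC.
  by rewrite -[leLHS]/(m (~` [set` s])) probability_setC// mS1 subee.
move=> A mA; rewrite one// [RHS]one//; last first.
  by rewrite -m11; apply: eq_big_seq => t ts; rewrite ms.
rewrite !sumE// big_seq_cond [RHS]big_seq_cond.
by apply: eq_bigr => t /andP[ts _]; exact: ms.
Qed.

Section slot_law.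
Context {R : realType} {d : nat}.
Variables (law_xi : probability nat R) (q : R).
Hypothesis d_gt0 : (0 < d)%N.
Implicit Types (Q : probability (slot R d) R) (i j v : node d).

(** The one-slot form of [network_drivers]. By [slot_law_unique] these clauses determine the law,
    which yields both that all slots have the same law and that it is translation invariant. *)
Definition slot_law Q : Prop :=
  [/\ forall i (A : set nat), Q ((fun e => e.1.1 i) @^-1` A) = law_xi A,
      forall i (B : set R), measurable B ->
        Q ((fun e => e.1.2 i) @^-1` B) = uniform_prob (@ltr01 R) B,
      forall j, Q ((fun e => e.2 j) @^-1` [set None]) = q%:E /\
        forall i, i \in nbrs j ->
          Q ((fun e => e.2 j) @^-1` [set Some i]) = ((1 - q) / (2 * d%:R))%:E &
      mutually_independent Q slot_sigma].

Lemma size_nbrs i : size (nbrs i) = (2 * d)%N.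
Proof.
by rewrite size_map size_cat !(size_map _ (enum 'I_d)) size_enum_ord addnn mul2n.
Qed.

Lemma delta_row_entry (a : 'I_d) : (delta_mx 0 a : node d) 0 a = 1.
Proof. by rewrite mxE !eqxx. Qed.

Lemma delta_row_inj : injective (fun a : 'I_d => delta_mx 0 a : node d).
Proof.
move=> a b /matrixP/(_ 0 a)/esym; rewrite delta_row_entry mxE eqxx /=.
by case: eqP.
Qed.

Lemma uniq_unit_steps : uniq (unit_steps d).
Proof.
have u1 : uniq [seq delta_mx 0 a : node d | a <- enum 'I_d].
  by rewrite (map_inj_uniq delta_row_inj) enum_uniq.
have u2 : uniq [seq - (delta_mx 0 a : node d) | a <- enum 'I_d].
  rewrite (map_inj_uniq (f := fun a => - delta_mx 0 a)) ?enum_uniq//.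
  by move=> a b /eqP; rewrite eqr_opp => /eqP/delta_row_inj.
rewrite cat_uniq u1 u2 andbT /=.
apply/hasPn => _ /mapP[a _ ->]; apply/negP => /mapP[b _].
move=> /matrixP/(_ 0 a); rewrite mxE delta_row_entry mxE.
by case: (_ && _).
Qed.

Lemma uniq_nbrs i : uniq (nbrs i).
Proof. by rewrite map_inj_uniq ?uniq_unit_steps//; exact: addrI. Qed.

Lemma unit_stepsN e : (- e \in unit_steps d) = (e \in unit_steps d).
Proof.
suff H f : f \in unit_steps d -> - f \in unit_steps d.
  by apply/idP/idP => /H //; rewrite opprK.
rewrite !mem_cat => /orP[/mapP[a _ ->]|/mapP[a _ ->]]; apply/orP.
  by right; apply/mapP; exists a; rewrite ?mem_enum.
by left; apply/mapP; exists a; rewrite ?mem_enum ?opprK.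
Qed.

Lemma nbrs_sym i j : (i \in nbrs j) = (j \in nbrs i).
Proof.
suff H (k l : node d) : k \in nbrs l -> l \in nbrs k by apply/idP/idP => /H.
rewrite /nbrs => /mapP[e es ->]; apply/mapP; exists (- e); first by rewrite unit_stepsN.
by rewrite addrK.
Qed.

Lemma notin_nbrs i : i \notin nbrs i.
Proof.
rewrite /nbrs; apply/negP => /mapP[e es] /eqP; rewrite -subr_eq0 opprD addrA subrr sub0r
  oppr_eq0.
move=> /eqP e0; move: es; rewrite e0 mem_cat => /orP[|] /mapP[a _];
  move=> /matrixP/(_ 0 a); rewrite [in LHS]mxE.
  by rewrite delta_row_entry.
by rewrite mxE delta_row_entry.
Qed.

Lemma slot_sigma_measurable l : @slot_sigma R d l `<=` (@measurable _ (slot R d)).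
Proof. by move=> A lA; apply: sub_sigma_algebra; exists l. Qed.

Lemma slot_sigmaI l : setI_closed (@slot_sigma R d l).
Proof. by case: l => [[i|i]|i]; exact: preimage_sigmaI. Qed.

Lemma slot_sigmaT l : @slot_sigma R d l setT.
Proof. by case: l => [[i|i]|i]; exact: preimage_sigmaT. Qed.

Lemma slot_law_unique Q1 Q2 : slot_law Q1 -> slot_law Q2 ->
  forall A, measurable A -> Q1 A = Q2 A.
Proof.
move=> [a1 u1 r1 ind1] [a2 u2 r2 ind2] A mA.
refine (@law_unique R _ (slot R d) _ slot_sigma slot_sigma_measurable slot_sigmaI
  slot_sigmaT Q1 Q2 ind1 ind2 _ A mA).
move=> [[i|i]|j] _ [B mB <-]; rewrite setTI; [by rewrite a1 a2|by rewrite u1// u2|].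
pose mr := @measurable_slot_route R d j.
rewrite -!(lawE _ mr).
apply: (finite_support_unique (T := destination d) (s := None :: map Some (nbrs j))) => //.
- rewrite /= map_inj_uniq ?uniq_nbrs ?andbT; last exact: Some_inj.
  by apply/negP => /mapP[].
- move=> t; rewrite inE (lawE Q1 mr) (lawE Q2 mr) => /predU1P[->|/mapP[i ij ->]].
    by rewrite (r1 j).1 (r2 j).1.
  by rewrite (r1 j).2// (r2 j).2.
(* The total is [q + 2d (1 - q) / (2d) = 1], which is where [0 < d] enters. *)
rewrite big_cons big_map (lawE Q1 mr) (r1 j).1.
under eq_big_seq => i ij do rewrite (lawE Q1 mr) (r1 j).2//.
rewrite sumEFin big_const_seq count_predT size_nbrs iter_addr_0 -EFinD.
congr (_%:E); rewrite -[_ *+ (2 * d)]mulr_natr natrM mulfVK ?subrKC//.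
by rewrite -natrM pnatr_eq0 -lt0n muln_gt0.
Qed.

Lemma slot_law_shift Q v : slot_law Q -> slot_law (law Q (measurable_slot_shift v)).
Proof.
move=> [a1 u1 r1 ind1]; split.
- by move=> i A; rewrite lawE -(a1 (i + v)).
- by move=> i B mB; rewrite lawE -(u1 (i + v)).
- move=> j; split.
    rewrite lawE -(r1 (j + v)).1; congr (Q _); apply/seteqP; split=> e /=.
      by case: (e.2 (j + v)).
    by move=> ->.
  move=> i ij; rewrite lawE -((r1 (j + v)).2 (i + v)); last first.
    by rewrite nbrs_shift; exact: map_f.
  congr (Q _); apply/seteqP; split=> e /=.
    by case: (e.2 (j + v)) => //= z [<-]; rewrite subrK.
  by move=> ->; rewrite /= addrK.
- apply: (law_independent (idx := fun l => match l with
    | inl (inl i) => inl (inl (i + v))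
    | inl (inr i) => inl (inr (i + v))
    | inr i => inr (i + v) end)) ind1.
    by move=> [[i|i]|i] [[j|j]|j] // [] /addIr ->.
  move=> [[i|i]|i] _ [B mB <-]; rewrite setTI.
  + by exists B => //; rewrite setTI.
  + by exists B => //; rewrite setTI.
  + exists ((fun o => omap (fun z => z - v) o : destination d) @^-1` B) => //.
    by rewrite setTI.
Qed.

Lemma slot_shift_law Q v A : slot_law Q -> measurable A ->
  Q (slot_shift v @^-1` A) = Q A.
Proof.
move=> QL mA; rewrite -(lawE Q (measurable_slot_shift v)).
by apply: slot_law_unique => //; exact: slot_law_shift.
Qed.

End slot_law.

(** * The queues as a Markov chain *)

Section transition.
Context {R : realType} {d : nat}.
Implicit Types (mu nu : probability (state d) R) (Q : probability (slot R d) R).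

Definition transition alg Q mu : probability (state d) R :=
  law (mu \x Q)%E (@measurable_stepmap R d alg).

Lemma product_prob_ext {d1 d2} {T1 : measurableType d1} {T2 : measurableType d2}
    (m1 m1' : probability T1 R) (m2 m2' : probability T2 R) :
  (forall A, measurable A -> m1 A = m1' A) ->
  (forall A, measurable A -> m2 A = m2' A) ->
  forall E, measurable E -> (m1 \x m2)%E E = (m1' \x m2')%E E.
Proof.
move=> e1 e2 E mE; apply: product_measure_unique => // A B mA mB.
rewrite [LHS]product_measure1E//; congr (_ * _)%E; apply/esym; [exact: e1|exact: e2].
Qed.

Lemma transition_ext alg Q Q' mu nu : (forall A, measurable A -> mu A = nu A) ->
  (forall A, measurable A -> Q A = Q' A) ->
  forall A, measurable A -> transition alg Q mu A = transition alg Q' nu A.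
Proof.
move=> e1 e2 A mA.
apply: (product_prob_ext (E := stepmap alg @^-1` A) e1 e2).
by rewrite -[X in measurable X]setTI; exact: measurable_stepmap.
Qed.

(** Tonelli with the second factor outermost: the drivers are frozen first and the law of the state
    is evaluated on the section, as the passage to the limit requires. *)
Lemma product_prob_section {d1 d2} {T1 : measurableType d1} {T2 : measurableType d2}
    (m1 : probability T1 R) (m2 : probability T2 R) E : measurable E ->
  (m1 \x m2)%E E = (\int[m2]_y m1 [set x | E (x, y)])%E.
Proof.
move=> mE; transitivity ((m1 \x^ m2)%E E).
  apply: (product_measure_unique (m' := (m1 \x^ m2)%E)) => // A B mA mB.
  exact: product_measure2E.
apply: eq_integral => y _ /=; congr (m1 _); apply/seteqP; split=> x /=;
  by rewrite /ysection /= inE.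
Qed.

End transition.

Section markov.
Context {R : realType} {d : nat} {dO : measure_display}
  {Omega : measurableType dO} (P : probability Omega R).
Variables (xi : nat -> node d -> {RV P >-> nat})
  (U : nat -> node d -> {RV P >-> R})
  (r : nat -> node d -> {RV P >-> destination d})
  (law_xi : probability nat R) (q : R).
Hypothesis d_gt0 : (0 < d)%N.
Hypothesis drivers : network_drivers xi U r law_xi q.

Definition slot_of (k : nat) (w : Omega) : slot R d :=
  ((fun i => xi k i w, fun i => U k i w), fun i => r k i w).

Lemma measurable_slot_of k : measurable_fun setT (slot_of k).
Proof. by apply: measurable_fun_slot => i; exact: measurable_funP. Qed.

Lemma slot_of_law k : slot_law law_xi q (law P (measurable_slot_of k)).
Proof.
have [a1 u1 r1 ind] := drivers; split.
- by move=> i A; rewrite lawE -(a1 k i).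
- by move=> i B mB; rewrite lawE -(u1 k i).
- by move=> j; exact: (r1 k j).
apply: (law_independent (idx := fun l => match l with
    | inl (inl i) => inl (inl (k, i))
    | inl (inr i) => inl (inr (k, i))
    | inr i => inr (k, i) end)) ind.
  by move=> [[i|i]|i] [[j|j]|j] // [] ->.
by move=> [[i|i]|i] _ [B mB <-]; exists B => //; rewrite setTI.
Qed.

Definition slot_index (l : nat * node d + nat * node d + nat * node d) : nat :=
  match l with inl (inl (k, _)) | inl (inr (k, _)) | inr (k, _) => k end.

Let dsig := driver_sigma xi U r.

Let dsig_measurable l : dsig l `<=` measurable.
Proof. by case: l => [[[k i]|[k i]]|[k i]] _ [B mB <-]; exact: measurable_funP. Qed.

Let dsigI l : setI_closed (dsig l).
Proof. by case: l => [[[k i]|[k i]]|[k i]]; exact: preimage_sigmaI. Qed.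

Let dsigT l : dsig l setT.
Proof. by case: l => [[[k i]|[k i]]|[k i]]; exact: preimage_sigmaT. Qed.

Lemma slot_of_group (D : set (nat * node d + nat * node d + nat * node d)) k :
  (forall l, slot_index l = k -> D l) ->
  measurable_fun [set: g_sigma_algebraType (\bigcup_(l in D) dsig l)] (slot_of k).
Proof.
move=> Dk; apply: measurable_fun_slot => i _ B mB; apply: sub_sigma_algebra.
- by exists (inl (inl (k, i))); [exact: Dk|exists B].
- by exists (inl (inr (k, i))); [exact: Dk|exists B].
- by exists (inr (k, i)); [exact: Dk|exists B].
Qed.

(** From a fixed initial state, the queues in slot [k] are built from the drivers of slots before
    [k] only, hence are independent of slot [k]. *)
Lemma Xproc_group (D : set (nat * node d + nat * node d + nat * node d)) alg x k :
  (forall l, (slot_index l < k)%N -> D l) ->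
  measurable_fun [set: g_sigma_algebraType (\bigcup_(l in D) dsig l)]
    (fun w : Omega => Xproc xi U r alg k (x, w)).
Proof.
elim: k => [//|k IH] Dk.
apply: (measurableT_comp (f := stepmap alg) (g := fun w : g_sigma_algebraType _ =>
  (Xproc xi U r alg k (x, w), slot_of k w))); first exact: measurable_stepmap.
apply: measurable_fun_pair.
  by apply: IH => l lk; apply: Dk; rewrite ltnS ltnW.
by apply: slot_of_group => l lk; apply: Dk; rewrite lk.
Qed.

Lemma Xproc_slot_independent alg x k (A : set (state d)) (B : set (slot R d)) :
  measurable A -> measurable B ->
  P ((fun w => Xproc xi U r alg k (x, w)) @^-1` A `&` slot_of k @^-1` B) =
  (P ((fun w => Xproc xi U r alg k (x, w)) @^-1` A) * P (slot_of k @^-1` B))%E.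
Proof.
move=> mA mB; have [_ _ _ ind] := drivers.
pose D1 := [set l | (slot_index l < k)%N]; pose D2 := [set l | slot_index l = k].
apply: (@independent_groups R _ Omega _ dsig dsig_measurable dsigI dsigT P D1 D2 ind).
- by rewrite -subset0 => l []; rewrite /D1 /D2 /= => + lk; rewrite lk ltnn.
- rewrite -[X in group_sets _ _ X]setTI.
  by apply: (@Xproc_group D1).
- rewrite -[X in group_sets _ _ X]setTI.
  by apply: (@slot_of_group D2).
Qed.

Lemma measurable_Xproc alg k : measurable_fun setT (Xproc xi U r alg k).
Proof.
elim: k => [|k IH]; first exact: measurable_fst.
apply: (measurableT_comp (f := stepmap alg) (g := fun w : state d * Omega =>
  (Xproc xi U r alg k w, slot_of k w.2))); first exact: measurable_stepmap.
apply: measurable_fun_pair => //.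
exact: (measurableT_comp (measurable_slot_of k)).
Qed.

Definition slot_prob : probability (slot R d) R := law P (measurable_slot_of 0).

Lemma slot_probE k A : measurable A -> P (slot_of k @^-1` A) = slot_prob A.
Proof.
move=> mA; rewrite -(lawE P (measurable_slot_of k)).
by apply: (slot_law_unique d_gt0 (slot_of_law k) (slot_of_law 0)).
Qed.

(** The pair formed by the state and the drivers of slot [k] has a product law. This is checked on
    rectangles, by independence for each fixed initial state and then integration over [nu]. *)
Lemma Xproc_transition alg k (nu : probability (state d) R) A : measurable A ->
  law (nu \x P)%E (measurable_Xproc alg k.+1) A =
  transition alg slot_prob (law (nu \x P)%E (measurable_Xproc alg k)) A.
Proof.
move=> mA; have mS : measurable (stepmap alg @^-1` A : set (state d * slot R d)).
  by rewrite -[X in measurable X]setTI; exact: measurable_stepmap.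
have mj : measurable_fun setT (fun w : state d * Omega =>
    (Xproc xi U r alg k w, slot_of k w.2)).
  apply: measurable_fun_pair; first exact: measurable_Xproc.
  exact: (measurableT_comp (measurable_slot_of k)).
rewrite -[RHS]/((law (nu \x P)%E (measurable_Xproc alg k) \x slot_prob)%E
  (stepmap alg @^-1` A)) [RHS](product_measure_unique (m' := law (nu \x P)%E mj))//.
move=> B C mB mC.
have mXB : measurable (Xproc xi U r alg k @^-1` B).
  by rewrite -[X in measurable X]setTI; exact: measurable_Xproc.
have xsE (E : set (state d * Omega)) x : xsection E x = [set w | E (x, w)].
  by apply/seteqP; split=> w; rewrite /xsection /= inE.
transitivity (\int[nu]_x (P (xsection (Xproc xi U r alg k @^-1` B) x) * slot_prob C))%E.
  apply: eq_integral => x _ /=; rewrite -(slot_probE k)// !xsE.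
  exact: (Xproc_slot_independent _ _ _ mB mC).
rewrite ge0_integralZr//.
exact: (measurable_fun_xsection P mXB).
Qed.

Lemma transition_stationary alg (pi : probability (state d) R) :
  (forall A, measurable A -> transition alg slot_prob pi A = pi A) ->
  stationary xi U r alg pi.
Proof.
move=> pi_inv k; elim: k => [|k IH] A mA.
  rewrite /pushforward /= -[LHS]/((pi \x P)%E (fst @^-1` A)).
  rewrite (_ : fst @^-1` A = A `*` setT).
    by rewrite [LHS]product_measure1E// [X in (_ * X)%E]probability_setT mule1.
  by apply/seteqP; split=> [[x w]|[x w] []].
rewrite -[LHS](lawE (pi \x P)%E (measurable_Xproc alg k.+1)) Xproc_transition//.
rewrite -[RHS]pi_inv//; apply: transition_ext mA => // B mB; exact: IH.
Qed.

End markov.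

(** * Service probabilities *)

Section uniform_power.
Context {R : realType}.

Lemma derivable_powR01 (c : R) : 0 < c ->
  derivable_oo_LRcontinuous (fun t : R => t `^ c) 0 1.
Proof.
move=> c0; split.
- by move=> x; rewrite in_itv/= => /andP[x0 _]; apply: derivable_powR; rewrite in_itv/= x0.
- by rewrite powR0 ?gt_eqF//; exact: powR_cvg0.
- apply: cvg_at_left_filter.
  have : {for 1, continuous (fun t : R => t `^ c : R^o)}.
    apply: differentiable_continuous; apply/derivable1_diffP.
    by apply: derivable_powR; rewrite in_itv/= ltr01.
  by [].
Qed.

Lemma integral_powR01 (c : R) : 0 <= c ->
  (\int[lebesgue_measure]_(t in `[0%R, 1%R]) (t `^ c)%:E = (1 + c)^-1%:E)%E.
Proof.
move=> c0; have c1 : 0 < 1 + c by rewrite ltr_wpDr.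
rewrite (@continuous_FTC2 R _ (fun t => (1 + c)^-1 *: (t `^ (1 + c) : R^o)) 0 1)//.
- by rewrite powR1 powR0 ?gt_eqF// scaler0 sube0 [_ *: _]mulr1.
(* For [c = 0] the integrand is constantly [1], also at [t = 0], while [derivable_powR01] supplies
   continuity only for positive exponents. *)
- move: c0; rewrite le_eqVlt => /predU1P[<-|c0].
    rewrite (_ : (fun t => t `^ 0) = cst 1); last by apply/funext => t; rewrite powRr0.
    by apply: continuous_subspaceT => x; exact: cvg_cst.
  by apply: derivable_oo_LRcontinuous_within; exact: derivable_powR01.
- have [d1 d2 d3] := derivable_powR01 c1; split.
  + by move=> x x01; apply: derivableZ; exact: d1.
  + exact: (@cvgZr _ R^o).
  + exact: (@cvgZr _ R^o).
- move=> x; rewrite in_itv/= => /andP[x0 _].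
  rewrite derive1E deriveZ//=; last by apply: derivable_powR; rewrite in_itv/= x0.
  rewrite -derive1E powR_derive1; last by rewrite in_itv/= x0.
  by rewrite [1 + c]addrC addrK [LHS]mulKf// gt_eqF// addrC.
Qed.

Lemma uniform_probE (B : set R) : measurable B ->
  uniform_prob (@ltr01 R) B = lebesgue_measure (B `&` `[0, 1]).
Proof.
move=> mB; transitivity (\int[uniform_prob (@ltr01 R)]_t (\1_B t)%:E)%E.
  by rewrite integral_indic// setIT.
rewrite integral_uniform//; last first.
  by apply/measurable_EFinP; exact: measurable_indic.
by rewrite subr0 invr1 mul1e integral_indic// setIC.
Qed.

Lemma uniform_prob_lt (t : R) : 0 <= t <= 1 ->
  uniform_prob (@ltr01 R) [set u | u < t] = t%:E.
Proof.
move=> /andP[t0 t1]; rewrite (_ : [set u | u < t] = `]-oo, t[%classic); last first.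
  by apply/seteqP; split=> u; rewrite /= in_itv.
rewrite uniform_probE//.
rewrite (_ : _ `&` _ = `[0, t[%classic).
  rewrite lebesgue_measure_itv /= lte_fin; case: ltgtP t0 => // [t0 _|<- _].
    by rewrite sube0.
  by [].
apply/seteqP; split=> u /=; rewrite !in_itv/=.
  by move=> [-> /andP[-> _]].
by move=> /andP[u0 ut]; rewrite ut u0 (ltW (lt_le_trans ut t1)).
Qed.

Lemma measurable_set_lt (a : R) : measurable [set u : R | u < a].
Proof.
have -> : [set u | u < a] = `]-oo, a[%classic.
  by apply/seteqP; split=> u; rewrite /= in_itv.
exact: measurable_itv.
Qed.

End uniform_power.

Lemma measure_eq_off_null {R : realType} {dT} {T : measurableType dT}
    (m : probability T R) (A B N : set T) : measurable A -> measurable B ->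
  measurable N -> m N = 0%E -> (forall x, ~ N x -> A x <-> B x) -> m A = m B.
Proof.
move=> mA mB mN N0 AB.
have drop C : measurable C -> m C = m (C `\` N).
  move=> mC; rewrite (measureDI m mC mN) [X in (_ + X)%E](_ : _ = 0%E) ?adde0//.
  apply/eqP; rewrite -measure_le0 -N0; apply: le_measure; rewrite ?inE//.
  exact: measurableI.
rewrite drop// [RHS]drop//; congr (m _).
by apply/seteqP; split=> x [? ?]; split=> //; apply/AB.
Qed.

Section eta_law.
Context {R : realType} {d : nat}.
Variables (law_xi : probability nat R) (q : R).
Implicit Types (x : state d) (i j : node d).

(* An empty [j] has [tau = +oo] and exponent [0], so it never prevents service. *)
Lemma tau_lt x (u : node d -> R) i j : (0 < x i)%N -> 0 < u i < 1 -> u j < 1 ->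
  (tau x u i < tau x u j)%E = (u j < u i `^ ((x j)%:R / (x i)%:R)).
Proof.
move=> xi0 /andP[ui0 ui1] uj1; rewrite /tau (gtn_eqF xi0) /= leNgt ui0 /=.
have nV : 0 < (x i)%:R^-1 :> R by rewrite invr_gt0 ltr0n.
have [->|xj0] := eqVneq (x j) 0%N.
  by rewrite -EFinM ltry mul0r powRr0 uj1.
have mV : 0 < (x j)%:R^-1 :> R by rewrite invr_gt0 ltr0n lt0n.
have [uj0|uj0] := leP (u j) 0.
  rewrite gt0_mulye ?lte_fin// -EFinM ltry; apply/esym.
  by rewrite (le_lt_trans uj0)// powR_gt0.
rewrite -!EFinM lte_fin !mulNr ltrN2.
rewrite -[RHS]ltr_ln ?posrE ?powR_gt0// ln_powR.
rewrite -(ltr_pM2r (_ : 0 < (x j)%:R)) ?ltr0n ?lt0n//.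
by rewrite divfK ?pnatr_eq0//; congr (_ < _); ring.
Qed.

Variable Q : probability (slot R d) R.
Hypothesis QL : slot_law law_xi q Q.

Lemma slot_uniform_null j :
  Q [set e | ~~ (0 < e.1.2 j < 1)] = 0%E.
Proof.
have [_ Qu _ _] := QL.
rewrite (_ : [set e | _] = (fun e => e.1.2 j) @^-1` (~` `]0, 1[)); last first.
  by apply/seteqP; split=> e /=; rewrite in_itv/= => /negP.
rewrite Qu; last exact: measurableC.
rewrite [LHS]probability_setC// [X in (_ - X)%E]uniform_probE// (_ : _ `&` _ = `]0,
  1[%classic); last first.
  by apply/setIidPl => t /=; rewrite !in_itv/= => /andP[/ltW -> /ltW ->].
by rewrite lebesgue_measure_itv /= lte_fin ltr01 sube0 subee.
Qed.

(** The base [t = 0] needs separate care because of the convention that [0] to the power [0] is [1]: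
    the product vanishes as soon as one exponent is positive. *)
Lemma prod_powR (t : R) (s : seq (node d)) (c : node d -> R) :
  (forall j, 0 <= c j) -> \prod_(j <- s) t `^ c j = t `^ (\sum_(j <- s) c j).
Proof.
move=> c0; elim: s => [|j s IH]; first by rewrite !big_nil powRr0.
rewrite !big_cons IH.
have [->|t0] := eqVneq t 0; last by rewrite powRD// t0 implybT.
have [->|cj0] := eqVneq (c j) 0; first by rewrite powRr0 mul1r add0r.
by rewrite [in LHS]powR0// mul0r powR0// paddr_eq0 ?sumr_ge0// negb_and cj0.
Qed.

Lemma slot_uniform_all (t : R) (s : seq (node d)) (c : node d -> R) :
  uniq s -> 0 <= t <= 1 -> (forall j, 0 <= c j) ->
  Q [set e | all (fun j => e.1.2 j < t `^ c j) s] =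
  (t `^ (\sum_(j <- s) c j))%:E.
Proof.
move=> us t01 c0; have [_ Qu _ ind] := QL.
pose A (l : node d + node d + node d) : set (slot R d) :=
  match l with inl (inr j) => [set e : slot R d | e.1.2 j < t `^ c j] | _ => setT end.
have -> : [set e : slot R d | all (fun j => e.1.2 j < t `^ c j) s] =
    \bigcap_(l in [set` map (fun j => inl (inr j)) s]) A l.
  apply/seteqP; split=> e /=.
    by move=> /allP h l /= /mapP[j js ->]; exact: h.
  move=> h; apply/allP => j js; apply: (h (inl (inr j))) => /=.
  by apply/mapP; exists j.
have tc j : 0 <= t `^ c j <= 1.
  case/andP: t01 => t0 t1; rewrite powR_ge0/=.
  have := ge0_ler_powR (c0 j); move=> /(_ t 1); rewrite !nnegrE powR1; exact.
rewrite ind; last 2 first.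
- by rewrite map_inj_uniq// => j k [].
- move=> _ /mapP[j js ->]; exists [set u : R | u < t `^ c j]; last by rewrite setTI.
  exact: measurable_set_lt.
rewrite big_map -prod_powR// -prodEFin.
apply: eq_bigr => j _ /=; rewrite -(uniform_prob_lt (tc j)) -(Qu j)//.
exact: measurable_set_lt.
Qed.

Lemma measurable_race i (s : seq (node d)) (c : node d -> R) :
  measurable [set e : slot R d | all (fun j => e.1.2 j < e.1.2 i `^ c j) s].
Proof.
suff mb : measurable_fun setT (fun e : slot R d =>
    all (fun j => e.1.2 j < e.1.2 i `^ c j) s).
  by rewrite -[X in measurable X]setTI; exact: (mb measurableT [set true]).
elim: s => [|k s IH] /=; first exact: measurable_cst.
apply: measurable_and => //; apply: measurable_fun_ltr.
  exact: measurable_slot_uniform.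
apply: (measurableT_comp (f := fun t : R => t `^ c k)) => //.
exact: measurable_slot_uniform.
Qed.

(* On the sigma-algebra generated by all drivers but [U_i], the identity map is
   independent of [U_i]; the race is then integrated over the value of [U_i]. *)
Definition other_uniforms i : set (set (slot_values R d)) :=
  \bigcup_(l in ~` [set inl (inr i)]) slot_sigma l.

Lemma slot_uniform_race i (s : seq (node d)) (c : node d -> R) :
  uniq s -> i \notin s -> (forall j, 0 <= c j) ->
  Q [set e | all (fun j => e.1.2 j < e.1.2 i `^ c j) s] =
  ((1 + \sum_(j <- s) c j)^-1)%:E.
Proof.
move=> us si c0; have [_ Qu _ ind] := QL.
pose T2 := g_sigma_algebraType (other_uniforms i).
have mid : measurable_fun setT (fun e : slot R d => e : T2).
  apply: measurable_fun_generated => A [l _ lA].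
  by apply: sub_sigma_algebra; exists l.
have mU : measurable_fun setT (fun e : slot R d => e.1.2 i : measurableTypeR R).
  exact: measurable_slot_uniform.
pose Q2 := law Q mid.
have mpair : measurable_fun setT (fun e : slot R d => (e.1.2 i : measurableTypeR R, e : T2)).
  exact: measurable_fun_pair.
pose E : set (measurableTypeR R * T2) := [set p | all (fun j => p.2.1.2 j < p.1 `^ c j) s].
have mE : measurable E.
  have mb : measurable_fun setT (fun p : measurableTypeR R * T2 => all (fun j => p.2.1.2 j
    < p.1 `^ c j) s).
    elim: s us si {E} => [//|k s IH] /= /andP[_ us]; rewrite inE negb_or => /andP[ik is'].
    apply: measurable_and; last exact: IH.
    apply: measurable_fun_ltr.
      apply: (measurableT_comp (f := fun e : T2 => e.1.2 k)) => //.
      move=> _ B mB; apply: sub_sigma_algebra; exists (inl (inr k)); last by exists B.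
      by move=> [] ki; rewrite ki eqxx in ik.
    apply: (measurableT_comp (f := fun t : measurableTypeR R => (t : R) `^ c k)) => //.
  rewrite -[X in measurable X]setTI; exact: (mb measurableT [set true]).
pose unif : probability (measurableTypeR R) R := uniform_prob (@ltr01 R).
transitivity ((unif \x Q2)%E E).
  transitivity (law Q mpair E) => //.
  apply/esym; apply: product_measure_unique => // A B mA mB.
  transitivity (Q ((fun e => e.1.2 i) @^-1` A) * Q B)%E; last by rewrite (Qu i A mA).
  apply: (@independent_groups R _ (slot R d) _ slot_sigma slot_sigma_measurable
    slot_sigmaI slot_sigmaT Q [set inl (inr i)] (~` [set inl (inr i)]) ind).
  - by rewrite setICr.
  - by apply: sub_sigma_algebra; exists (inl (inr i)) => //; exists A; rewrite ?setTI.
  - exact: mB.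
transitivity (\int[unif]_t (Q2 (xsection E t)))%E => //.
rewrite integral_uniform//; last exact: measurable_fun_xsection.
(* Given [U_i = t], the race is won with probability [t] to the power of the sum of the [c j]; this
   is then integrated over the unit interval. *)
rewrite subr0 invr1 mul1e -integral_powR01 ?sumr_ge0//.
apply: eq_integral => t; rewrite inE/= in_itv/= => t01.
rewrite -slot_uniform_all//; congr (Q _).
by apply/seteqP; split=> e; rewrite /xsection /= inE.
Qed.

Lemma measurable_slot_eta alg x i : measurable [set e : slot R d | eta alg x e.1.2 i].
Proof.
rewrite -[X in measurable X]setTI.
have mX : measurable_fun setT (fun _ : slot R d => x) by exact: measurable_cst.
have me := @measurable_eta R d _ _ _ (fun j (e : slot R d) => e.1.2 j) mX
  measurable_slot_uniform alg i.
exact: (me measurableT [set true]).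
Qed.

Lemma psi_ge0 x i : 0 <= psi x i :> R.
Proof. by rewrite /psi divr_ge0. Qed.

Lemma psi_le1 x i : psi x i <= 1 :> R.
Proof.
rewrite /psi big_cons; have [->|xi0] := posnP (x i); first by rewrite mul0r.
by rewrite ler_pdivrMr ?ltr0n ?addn_gt0 ?xi0// mul1r ler_nat leq_addr.
Qed.

(** Under (D2) this is the uniform law of [U_i]. Under (D1) the times [-log U_j / x_j] are
    independent exponential clocks with rates [x_j], and clock [i] rings first in its neighbourhood
    with probability [x_i] over the sum of the rates. The two algorithms enter the drift only
    through this probability. *)
Lemma eta_prob alg x i : Q [set e | eta alg x e.1.2 i] = (psi x i)%:E.
Proof.
have [xi0|xi0] := posnP (x i).
  rewrite (_ : [set e | _] = set0) ?measure0 /psi ?xi0 ?mul0r//.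
  by rewrite -subset0 => e; rewrite /= /eta xi0.
have [_ Qu _ _] := QL.
case: alg; last first.
  rewrite -(uniform_prob_lt (t := psi x i)) ?psi_ge0 ?psi_le1//.
  rewrite (_ : [set e | _] = (fun e => e.1.2 i) @^-1` [set u | u < psi x i]).
    by rewrite Qu//; exact: measurable_set_lt.
  by apply/seteqP; split=> e; rewrite /= /eta xi0.
pose c j : R := (x j)%:R / (x i)%:R.
have c0 j : 0 <= c j by rewrite divr_ge0.
transitivity ((1 + \sum_(j <- nbrs i) c j)^-1 : R)%:E; last first.
  congr (_%:E); rewrite /psi big_cons natrD natr_sum -mulr_suml.
  by rewrite -{1}(@divff _ (x i)%:R) ?pnatr_eq0 ?gtn_eqF// -mulrDl invf_div.
rewrite -(slot_uniform_race (uniq_nbrs i) (notin_nbrs i) c0).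
(* The race of the [tau] agrees with the race of powers only when the uniforms lie strictly between
   [0] and [1]; [N] is the null set of exceptions around [i]. *)
pose N := \bigcup_(j in [set` i :: nbrs i]) [set e : slot R d | ~~ (0 < e.1.2 j < 1)].
have mNj j : measurable [set e : slot R d | ~~ (0 < e.1.2 j < 1)].
  rewrite (_ : [set e | _] = (fun e : slot R d => e.1.2 j) @^-1` (~` `]0, 1[)).
    rewrite -[X in measurable X]setTI; apply: measurable_slot_uniform => //.
    exact: measurableC.
  by apply/seteqP; split=> e /=; rewrite in_itv/= => /negP.
apply: (measure_eq_off_null (N := N)).
- exact: (measurable_slot_eta D1).
- exact: measurable_race.
- by apply: fin_bigcup_measurable => // j _; exact: mNj.
- rewrite /N; elim: (i :: nbrs i) => [|j s IH]; first by rewrite set_nil bigcup_set0 measure0.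
  apply/eqP; rewrite -measure_le0 (_ : \bigcup_(k in _) _ =
    [set e | ~~ (0 < e.1.2 j < 1)] `|`
    \bigcup_(k in [set` s]) [set e | ~~ (0 < e.1.2 k < 1)]).
    apply: (le_trans (measureU2 _ _ _)) => //.
      by apply: fin_bigcup_measurable.
    by rewrite [X in (X + _)%E](slot_uniform_null j) add0e [leLHS]IH.
  apply/seteqP; split=> e.
    by move=> [k /=]; rewrite inE => /predU1P[->|ks] he; [left|right; exists k].
  by move=> [he|[k /= ks he]]; [exists j|exists k] => //=; rewrite inE ?eqxx ?ks ?orbT.
- move=> e Ne /=; rewrite /eta xi0 /=.
  have ok j : j \in i :: nbrs i -> 0 < e.1.2 j < 1.
    by move=> js; apply: contrapT => /negP bad; apply: Ne; exists j.
  suff -> : all (fun j => (tau x e.1.2 i < tau x e.1.2 j)%E) (nbrs i) =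
    all (fun j => e.1.2 j < e.1.2 i `^ c j) (nbrs i) by [].
  apply: eq_in_all => j js; apply: tau_lt => //; first by rewrite ok ?mem_head.
  by have /andP[] : 0 < e.1.2 j < 1 by apply: ok; rewrite inE js orbT.
Qed.

End eta_law.

(** * Means over the drivers of one slot *)

Section mean.
Context {R : realType} {dT} {T : measurableType dT}.
Implicit Types (m : probability T R) (f g : T -> R).

(** For such functions means are additive in the extended reals with no integrability condition. For
    this reason the balances below are arranged with every term nonnegative on its side. *)
Definition nonneg_measurable f := measurable_fun setT f /\ forall w, 0 <= f w.

Lemma nonneg_measurableD f g : nonneg_measurable f -> nonneg_measurable g ->
  nonneg_measurable (fun w => f w + g w).
Proof.
by move=> [mf f0] [mg g0]; split=> [|w]; [exact: measurable_funD|exact: addr_ge0].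
Qed.

Lemma nonneg_measurableM f g : nonneg_measurable f -> nonneg_measurable g ->
  nonneg_measurable (fun w => f w * g w).
Proof.
by move=> [mf f0] [mg g0]; split=> [|w]; [exact: measurable_funM|exact: mulr_ge0].
Qed.

Lemma nonneg_measurable_cst (c : R) : 0 <= c -> nonneg_measurable (fun=> c).
Proof. by move=> c0; split=> // w. Qed.

Lemma nonneg_measurable_nat (f : T -> nat) : measurable_fun setT f ->
  nonneg_measurable (fun w => (f w)%:R).
Proof. by move=> mf; split=> [|w]; [exact: (measurable_fun_nat (fun n => n%:R : R))|exact:
  ler0n]. Qed.

Lemma nonneg_measurable_sum (I : Type) (s : seq I) (F : I -> T -> R) :
  (forall i, nonneg_measurable (F i)) ->
  nonneg_measurable (fun w => \sum_(i <- s) F i w).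
Proof.
move=> FM; split=> [|w]; last by apply: sumr_ge0 => i _; exact: (FM i).2.
by apply: measurable_sum => i; exact: (FM i).1.
Qed.

Definition mean m f : \bar R := (\int[m]_w (f w)%:E)%E.

Lemma mean_ge0 m f : (forall w, 0 <= f w) -> (0 <= mean m f)%E.
Proof. by move=> f0; apply: integral_ge0 => w _; rewrite lee_fin. Qed.

Lemma mean_ext m f g : f =1 g -> mean m f = mean m g.
Proof. by move=> fg; apply: eq_integral => w _; rewrite fg. Qed.

Lemma meanD m f g : nonneg_measurable f -> nonneg_measurable g ->
  mean m (fun w => f w + g w) = (mean m f + mean m g)%E.
Proof.
move=> [mf f0] [mg g0]; rewrite -ge0_integralD//.
- by move=> w _; rewrite lee_fin.
- exact/measurable_EFinP.
- by move=> w _; rewrite lee_fin.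
- exact/measurable_EFinP.
Qed.

Lemma meanZ m (c : R) f : 0 <= c -> nonneg_measurable f ->
  mean m (fun w => c * f w) = (c%:E * mean m f)%E.
Proof.
move=> c0 [mf f0]; rewrite -ge0_integralZl//.
- exact/measurable_EFinP.
- by move=> w _; rewrite lee_fin.
Qed.

Lemma mean_cst m (c : R) : mean m (fun=> c) = c%:E.
Proof. by rewrite /mean integral_cst// [X in (_ * X)%E]probability_setT mule1. Qed.

Lemma mean_sum m (I : Type) (s : seq I) (F : I -> T -> R) :
  (forall i, nonneg_measurable (F i)) ->
  mean m (fun w => \sum_(i <- s) F i w) = (\sum_(i <- s) mean m (F i))%E.
Proof.
move=> FM; elim: s => [|i s IH].
  rewrite big_nil -[RHS](mean_cst m 0); apply: mean_ext => w.
  by rewrite big_nil.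
rewrite big_cons -IH -meanD//; last exact: nonneg_measurable_sum.
by apply: mean_ext => w; rewrite big_cons.
Qed.

Lemma mean_le m f g : nonneg_measurable f -> nonneg_measurable g ->
  (forall w, f w <= g w) -> (mean m f <= mean m g)%E.
Proof.
move=> [mf f0] [mg g0] fg; apply: ge0_le_integral => //.
- by move=> w _; rewrite lee_fin.
- exact/measurable_EFinP.
- exact/measurable_EFinP.
- by move=> w _; rewrite lee_fin.
Qed.

Lemma mean_indic m (b : T -> bool) : measurable [set w | b w] ->
  mean m (fun w => (b w)%:R) = m [set w | b w].
Proof.
move=> mb; transitivity (\int[m]_w (\1_[set w | b w] w)%:E)%E.
  by apply: eq_integral => w _; rewrite indicE mem_setE.
by rewrite integral_indic// setIT.
Qed.

(** Integrating against the indicator of the event is integrating for [m] restricted to it, and by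
    independence the image of that restriction under [X] is the law of [X] scaled by the probability
    of the event. *)
Lemma mean_independent m (X : T -> nat) (b : T -> bool) (f : nat -> R) :
  measurable_fun setT X -> measurable [set w | b w] -> (forall n, 0 <= f n) ->
  (forall A : set nat, m (X @^-1` A `&` [set w | b w]) =
    (m (X @^-1` A) * m [set w | b w])%E) ->
  mean m (fun w => f (X w) * (b w)%:R) =
  (mean m (fun w => f (X w)) * m [set w | b w])%E.
Proof.
move=> mX mb f0 ind; set B := [set w | b w].
have mf : measurable_fun setT f by [].
have p0 : 0 <= fine (m B) by exact: fine_ge0.
pose mB := mscale (NngNum p0) (law m mX).
pose mr := mrestr m mb.
have mfX : measurable_fun setT (fun w => (f (X w))%:E).
  by apply/measurable_EFinP; exact: (measurableT_comp mf mX).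
transitivity (\int[mr]_w (f (X w))%:E)%E.
  rewrite -[in RHS](setvU B) ge0_integral_setU//; last 4 first.
  - exact: measurableC.
  - by rewrite setvU.
  - by move=> w _; rewrite lee_fin.
  - by rewrite disj_set2E setICl eqxx.
  rewrite [X in (X + _)%E]null_set_integral ?add0e; last 3 first.
  - exact: measurableC.
  - exact: measurable_funTS.
  - by rewrite -[LHS]/(m (~` B `&` B)) setICl measure0.
  rewrite (eq_measure_integral m); last first.
    by move=> A mA AB; rewrite /mr /mrestr; congr (m _); apply/setIidPl.
  rewrite integral_mkcond; apply: eq_integral => w _.
  rewrite patchE (_ : (w \in B) = b w); last by rewrite mem_setE.
  by case: (b w); rewrite ?mulr1 ?mulr0.
have mfE : measurable_fun setT (fun n => (f n)%:E) by exact/measurable_EFinP.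
transitivity (\int[pushforward mr X]_n (f n)%:E)%E.
  by rewrite ge0_integral_pushforward// => n _; rewrite lee_fin.
transitivity (\int[mB]_n (f n)%:E)%E.
  apply: eq_measure_integral => A mA _.
  transitivity (m (X @^-1` A) * m B)%E; first exact: ind.
  by rewrite -[RHS]/((fine (m B))%:E * m (X @^-1` A))%E fineK ?fin_num_measure// muleC.
rewrite ge0_integral_mscale//= => [|n _]; last by rewrite lee_fin.
rewrite fineK ?fin_num_measure// muleC; congr (_ * _)%E.
by rewrite ge0_integral_pushforward// => n _; rewrite lee_fin.
Qed.

End mean.

Lemma mean_law {R : realType} {d1 d2} {T1 : measurableType d1} {T2 : measurableType d2}
    (m : probability T1 R) (f : T1 -> T2) (mf : measurable_fun setT f) (g : T2 -> R) :
  nonneg_measurable g -> mean (law m mf) g = mean m (fun w => g (f w)).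
Proof.
move=> [mg g0]; rewrite /mean ge0_integral_pushforward//.
  exact/measurable_EFinP.
by move=> w _; rewrite lee_fin.
Qed.

Lemma mean_eq_measure {R : realType} {dT} {T : measurableType dT}
    (m1 m2 : probability T R) (g : T -> R) :
  (forall A, measurable A -> m1 A = m2 A) -> mean m1 g = mean m2 g.
Proof. by move=> e; apply: eq_measure_integral => A mA _; exact: e. Qed.

Section slot_means.
Context {R : realType} {d : nat}.
Variables (law_xi : probability nat R) (q a1 a2 : R).
Hypothesis mean1 : mean law_xi (fun n => n%:R) = a1%:E.
Hypothesis mean2 : mean law_xi (fun n => n%:R ^+ 2) = a2%:E.
Variable Q : probability (slot R d) R.
Hypothesis QL : slot_law law_xi q Q.
Variables (alg : algorithm) (x : state d) (i : node d).

Let kappa : R := (1 - q) / (2 * d%:R).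

(** Arrivals, uniforms and routes form three groups of drivers. Services depend on the uniforms
    alone, so every product of one-slot quantities whose mean is computed below splits across
    disjoint groups. *)
Let GA : set (node d + node d + node d) := [set l | if l is inl (inl _) then True else False].
Let GU : set (node d + node d + node d) := [set l | if l is inl (inr _) then True else False].
Let GR : set (node d + node d + node d) := [set l | if l is inr _ then True else False].

Let slot_group (D : set (node d + node d + node d)) : set (set (slot R d)) :=
  @group_sets _ (slot R d) _ slot_sigma D.

Let slot_group_measurable D : slot_group D `<=` measurable.
Proof.
apply: smallest_sub; first exact: sigma_algebra_measurable.
by move=> A [l _]; exact: slot_sigma_measurable.
Qed.

Lemma eta_group j : slot_group GU [set e : slot R d | eta alg x e.1.2 j].
Proof.
pose W := g_sigma_algebraType (\bigcup_(l in GU) @slot_sigma R d l).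
have mX : measurable_fun setT (fun _ : W => x) by exact: measurable_cst.
have mU k : measurable_fun [set: W] (fun e : W => e.1.2 k).
  by move=> _ B mB; apply: sub_sigma_algebra; exists (inl (inr k)) => //; exists B.
have me := @measurable_eta R d _ W _ (fun k (e : W) => e.1.2 k) mX mU alg j.
rewrite -[X in slot_group _ X]setTI.
exact: (me measurableT [set true]).
Qed.

Definition moves j (e : slot R d) : bool := (e.2 j == Some i) && eta alg x e.1.2 j.

Let slot_independent := @independent_groups R _ (slot R d) _ slot_sigma
  slot_sigma_measurable slot_sigmaI slot_sigmaT Q.

Lemma route_group j : slot_group GR [set e : slot R d | e.2 j == Some i].
Proof.
apply: sub_sigma_algebra; exists (inr j) => //; exists [set Some i] => //.
by rewrite setTI; apply/seteqP; split=> e /eqP.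
Qed.

Lemma moves_prob j : j \in nbrs i -> Q [set e | moves j e] = (kappa * psi x j)%:E.
Proof.
move=> ji; have [_ _ Qr ind] := QL.
rewrite (_ : [set e | _] = [set e : slot R d | e.2 j == Some i] `&`
    [set e : slot R d | eta alg x e.1.2 j]); last first.
  by apply/seteqP; split=> e /=; [move=> /andP|move=> ?; apply/andP].
rewrite (slot_independent (D1 := GR) (D2 := GU) ind); last 3 first.
- by rewrite -subset0 => -[[l|l]|l] [].
- exact: route_group.
- exact: eta_group.
rewrite (eta_prob QL) [RHS]EFinM; congr (_ * _)%E.
rewrite -((Qr j).2 i); last by rewrite nbrs_sym.
by congr (Q _); apply/seteqP; split=> e /eqP.
Qed.

Lemma measurable_moves j : measurable [set e : slot R d | moves j e].
Proof.
rewrite (_ : [set e | _] = [set e : slot R d | e.2 j == Some i] `&`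
    [set e : slot R d | eta alg x e.1.2 j]); last first.
  by apply/seteqP; split=> e /=; [move=> /andP|move=> ?; apply/andP].
apply: measurableI; last exact: measurable_slot_eta.
by apply: slot_group_measurable; exact: (route_group j).
Qed.

Lemma arrival_independent (B : set (slot R d)) (A : set nat) :
  slot_group (GU `|` GR) B ->
  Q ((fun e => e.1.1 i) @^-1` A `&` B) = (Q ((fun e => e.1.1 i) @^-1` A) * Q B)%E.
Proof.
move=> gB; have [_ _ _ ind] := QL.
apply: (slot_independent (D1 := GA) (D2 := GU `|` GR) ind) => //.
- by rewrite -subset0 => -[[l|l]|l] [] // _ [].
- by apply: sub_sigma_algebra; exists (inl (inl i)) => //; exists A; rewrite ?setTI.
Qed.

Lemma group_setsS (D D' : set (node d + node d + node d)) B : D `<=` D' ->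
  slot_group D B -> slot_group D' B.
Proof. by move=> DD'; apply: sub_sigma_algebra2; exact: bigcup_subset. Qed.

Lemma mean_arrival (f : nat -> R) : (forall n, 0 <= f n) ->
  mean Q (fun e => f (e.1.1 i)) = mean law_xi f.
Proof.
move=> f0; rewrite -(mean_law Q (measurable_slot_arrival i)).
  by apply: mean_eq_measure => A _; have [Qa _ _ _] := QL; exact: Qa.
by split.
Qed.

Lemma mean_arrival_event (b : slot R d -> bool) :
  slot_group (GU `|` GR) [set e | b e] ->
  mean Q (fun e => (e.1.1 i)%:R * (b e)%:R) = (a1%:E * Q [set e | b e])%E.
Proof.
move=> gb; rewrite -mean1 -(mean_arrival (f := fun n => n%:R))//.
apply: (mean_independent (f := fun n => n%:R)) => //.
- exact: measurable_slot_arrival.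
- exact: slot_group_measurable gb.
- by move=> A; exact: arrival_independent.
Qed.

Let A (e : slot R d) : R := (e.1.1 i)%:R.
Let B (e : slot R d) : R := \sum_(j <- nbrs i) (moves j e)%:R.
Let C (e : slot R d) : R := (eta alg x e.1.2 i)%:R.
Let X' (e : slot R d) : R := (stepmap alg (x, e) i)%:R.
Let psi_in : R := \sum_(j <- nbrs i) kappa * psi x j.

Let nmA : nonneg_measurable A.
Proof. by apply: nonneg_measurable_nat; exact: measurable_slot_arrival. Qed.

Lemma nonneg_measurable_bool (b : slot R d -> bool) : measurable [set e | b e] ->
  nonneg_measurable (fun e => (b e)%:R : R).
Proof.
move=> mb; apply: nonneg_measurable_nat.
apply: (measurableT_comp (f := nat_of_bool)) => //.
by apply: (measurable_fun_bool true); rewrite setTI.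
Qed.

Let nmm j : nonneg_measurable (fun e => (moves j e)%:R : R).
Proof. apply: nonneg_measurable_bool; exact: measurable_moves. Qed.

Let nmB : nonneg_measurable B.
Proof. exact: nonneg_measurable_sum. Qed.

Let nmC : nonneg_measurable C.
Proof. apply: nonneg_measurable_bool; exact: measurable_slot_eta. Qed.

Let nmX' : nonneg_measurable X'.
Proof.
apply: nonneg_measurable_nat.
have mp : measurable_fun setT (fun e : slot R d => (x, e)).
  exact: measurable_fun_pair.
apply: (measurableT_comp (measurable_coord i) (g := fun e : slot R d => stepmap alg (x, e))).
exact: (measurableT_comp (measurable_stepmap alg) mp).
Qed.

(** The subtraction on [nat] is exact: a service at [i] presupposes a job there. *)
Lemma step_balance e : X' e + C e = (x i)%:R + A e + B e.
Proof.
rewrite /X' /C /A /B /stepmap /step /=.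
rewrite -[LHS]natrD subnK; last first.
  rewrite -addnA (leq_trans _ (leq_addr _ _))// /eta.
  by have [->//|xi0] := posnP (x i); exact: leq_trans (leq_b1 _) xi0.
rewrite !natrD natr_sum; congr (_ + _); apply: eq_bigr => j _.
by rewrite mulnb.
Qed.

(** Each of the [2d] adjacent nodes sends at most one job per slot. This is the source of the factor
    [2d] in the numerator of the final bound. *)
Lemma inflow_sqr_le e : B e ^+ 2 <= 2 * d%:R * B e.
Proof.
rewrite expr2; apply: ler_wpM2r; first exact: nmB.2.
rewrite -natrM -(size_nbrs i) -sum1_size natr_sum.
by apply: ler_sum => j _; case: (moves j e).
Qed.

(** Expand the square of [x_i + A + B - C], use that [C] is an indicator, bound [B^2] by [2 d B] and
    discard [- 2 B C]. The remaining negative terms are moved to the left. *)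
Lemma step_sqr_le e :
  X' e ^+ 2 + (2 * (x i)%:R * C e + 2 * (A e * C e)) <=
  (x i)%:R ^+ 2 + 2 * (x i)%:R * A e + 2 * (x i)%:R * B e + A e ^+ 2 +
  2 * d%:R * B e + C e + 2 * (A e * B e).
Proof.
have -> : X' e = (x i)%:R + A e + B e - C e by rewrite -step_balance addrK.
have CE : C e ^+ 2 = C e by rewrite /C; case: (eta _ _ _ _); rewrite ?expr1n ?expr0n.
have BC : 0 <= B e * C e by rewrite mulr_ge0// ?nmB.2 ?nmC.2.
have := inflow_sqr_le e; rewrite -subr_ge0 => Bsq.
rewrite -subr_ge0.
rewrite (_ : _ - _ = (2 * d%:R * B e - B e ^+ 2) + 2 * (B e * C e) + (C e - C e ^+ 2)).
  by rewrite CE subrr addr0 addr_ge0// mulr_ge0.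
by ring.
Qed.

Let meanA : mean Q A = a1%:E.
Proof. by rewrite -mean1 -(mean_arrival (f := fun n => n%:R)). Qed.

Let meanAA : mean Q (fun e => A e ^+ 2) = a2%:E.
Proof.
by rewrite -mean2 -(mean_arrival (f := fun n => n%:R ^+ 2)).
Qed.

Let meanC : mean Q C = (psi x i)%:E.
Proof. by rewrite mean_indic ?(eta_prob QL)//; exact: measurable_slot_eta. Qed.

Let meanB : mean Q B = psi_in%:E.
Proof.
rewrite mean_sum// -sumEFin; apply: eq_big_seq => j ji.
by rewrite mean_indic ?moves_prob//; exact: measurable_moves.
Qed.

Let meanAC : mean Q (fun e => A e * C e) = (a1 * psi x i)%:E.
Proof.
rewrite mean_arrival_event ?(eta_prob QL)//.
by apply: group_setsS (eta_group i) => l; left.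
Qed.

Let meanAB : mean Q (fun e => A e * B e) = (a1 * psi_in)%:E.
Proof.
rewrite (@mean_ext _ _ _ Q _ (fun e => \sum_(j <- nbrs i) A e * (moves j e)%:R)); last first.
  by move=> e; rewrite /B mulr_sumr.
rewrite mean_sum; last by move=> j; exact: nonneg_measurableM.
rewrite /psi_in mulr_sumr -sumEFin; apply: eq_big_seq => j ji.
rewrite mean_arrival_event ?moves_prob//.
rewrite (_ : [set e | _] = [set e : slot R d | e.2 j == Some i] `&`
    [set e : slot R d | eta alg x e.1.2 j]); last first.
  by apply/seteqP; split=> e /=; [move=> /andP|move=> ?; apply/andP].
apply: (@measurableI _ (g_sigma_algebraType (\bigcup_(l in GU `|` GR) @slot_sigma R d l))).
  by apply: group_setsS (route_group j) => l; right.
by apply: group_setsS (eta_group j) => l; left.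
Qed.

Lemma mean_step : (mean Q X' + (psi x i)%:E)%E = ((x i)%:R + a1 + psi_in)%:E.
Proof.
rewrite -meanC -meanD// (mean_ext Q step_balance).
have nx : nonneg_measurable (fun _ : slot R d => (x i)%:R : R).
  exact: nonneg_measurable_cst.
by rewrite (meanD _ (nonneg_measurableD nx nmA) nmB) (meanD _ nx nmA) mean_cst meanA meanB.
Qed.

Lemma mean_step_sqr :
  (mean Q (fun e => X' e ^+ 2)%R
    + (2 * (x i)%:R * psi x i + 2 * (a1 * psi x i))%:E <=
   ((x i)%:R ^+ 2 + 2 * (x i)%:R * a1 + 2 * (x i)%:R * psi_in + a2
    + 2 * d%:R * psi_in + psi x i + 2 * (a1 * psi_in))%:E)%E.
Proof.
have nmc (c : R) (f : slot R d -> R) : 0 <= c -> nonneg_measurable f ->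
    nonneg_measurable (fun e : slot R d => c * f e).
  by move=> c0 nf; apply: nonneg_measurableM => //; exact: nonneg_measurable_cst.
have nmsq (f : slot R d -> R) : nonneg_measurable f -> nonneg_measurable (fun e : slot R d
  => f e ^+ 2).
  by move=> nf; apply: nonneg_measurableM.
have nX : 0 <= 2 * (x i)%:R :> R by rewrite mulr_ge0.
have n2d : 0 <= 2 * d%:R :> R by rewrite mulr_ge0.
have nm1 := nmc _ _ nX nmC.
have nm2 := nmc _ _ (ler0n R 2) (nonneg_measurableM nmA nmC).
have nm3 := nmc _ _ nX nmA.
have nm4 := nmc _ _ nX nmB.
have nm5 := nmsq _ nmA.
have nm6 := nmc _ _ n2d nmB.
have nm7 := nmc _ _ (ler0n R 2) (nonneg_measurableM nmA nmB).
have nm0 : nonneg_measurable (fun _ : slot R d => (x i)%:R ^+ 2 : R).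
  by apply: nonneg_measurable_cst; rewrite exprn_ge0.
have nX2 := nmsq _ nmX'.
have D (f g : slot R d -> R) := @nonneg_measurableD R _ (slot R d) f g.
have := mean_le Q (D _ _ nX2 (D _ _ nm1 nm2))
  (D _ _ (D _ _ (D _ _ (D _ _ (D _ _ (D _ _ nm0 nm3) nm4) nm5) nm6) nmC) nm7) step_sqr_le.
rewrite (meanD _ nX2 (D _ _ nm1 nm2)) (meanD _ nm1 nm2).
rewrite (meanD _ (D _ _ (D _ _ (D _ _ (D _ _ (D _ _ nm0 nm3) nm4) nm5) nm6) nmC) nm7).
rewrite (meanD _ (D _ _ (D _ _ (D _ _ (D _ _ nm0 nm3) nm4) nm5) nm6) nmC).
rewrite (meanD _ (D _ _ (D _ _ (D _ _ nm0 nm3) nm4) nm5) nm6).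
rewrite (meanD _ (D _ _ (D _ _ nm0 nm3) nm4) nm5).
rewrite (meanD _ (D _ _ nm0 nm3) nm4) (meanD _ nm0 nm3) mean_cst.
rewrite !(meanZ _ nX)// !(meanZ _ (ler0n R 2)) ?(meanZ _ n2d)//; last 2 first.
- exact: nonneg_measurableM.
- exact: nonneg_measurableM.
by rewrite meanA meanB meanC meanAA meanAC meanAB.
Qed.

End slot_means.

(** * The drift inequality *)

Section drift.
Context {R : realType} {d : nat}.
Variables (law_xi : probability nat R) (q a1 a2 : R).
Hypothesis d_gt0 : (0 < d)%N.
Hypothesis q01 : 0 < q < 1.
Hypothesis mean1 : mean law_xi (fun n => n%:R) = a1%:E.
Hypothesis mean2 : mean law_xi (fun n => n%:R ^+ 2) = a2%:E.
Variable Q : probability (slot R d) R.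
Hypothesis QL : slot_law law_xi q Q.
Variable alg : algorithm.
Implicit Types (mu : probability (state d) R) (x : state d) (i j v : node d).

Lemma mean_translate mu v (g : state d -> R) : translation_invariant mu ->
  nonneg_measurable g -> mean mu (fun x => g (translate v x)) = mean mu g.
Proof.
move=> inv ng; rewrite -(mean_law mu (measurable_translate v))//.
by apply: mean_eq_measure => A mA; exact: inv.
Qed.

(** [stepmap] commutes with shifting the state and the drivers together, and this joint shift
    preserves the product law, as is checked on rectangles. *)
Lemma transition_translation_invariant mu : translation_invariant mu ->
  translation_invariant (transition alg Q mu).
Proof.
move=> inv v A mA.
have mA' : measurable (stepmap alg @^-1` A : set (state d * slot R d)).
  by rewrite -[X in measurable X]setTI; exact: measurable_stepmap.
pose T (w : state d * slot R d) : state d * slot R d :=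
  (translate v w.1, slot_shift v w.2).
have mT : measurable_fun setT T.
  apply: measurable_fun_pair.
    exact: (measurableT_comp (measurable_translate v)).
  exact: (measurableT_comp (measurable_slot_shift v)).
transitivity (law (mu \x Q)%E mT (stepmap alg @^-1` A)).
  rewrite lawE -[LHS]/((mu \x Q)%E (stepmap alg @^-1` (translate v @^-1` A))).
  congr ((mu \x Q)%E _); apply/seteqP; split=> -[x e] /=;
    by rewrite /T /= stepmap_shift.
apply/esym; apply: (product_measure_unique (m' := law (mu \x Q)%E mT)) => // B C mB mC.
have mtB : measurable (translate v @^-1` B).
  by rewrite -[X in measurable X]setTI; exact: measurable_translate.
have msC : measurable (slot_shift v @^-1` C : set (slot R d)).
  by rewrite -[X in measurable X]setTI; exact: measurable_slot_shift.
transitivity ((mu \x Q)%E ((translate v @^-1` B) `*` (slot_shift v @^-1` C))) => //.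
rewrite [LHS]product_measure1E//; congr (_ * _)%E; first exact: inv.
exact: (slot_shift_law d_gt0 v QL mC).
Qed.

Lemma mean_transition mu (g : state d -> R) : nonneg_measurable g ->
  mean (transition alg Q mu) g = (\int[mu]_x mean Q (fun e => g (stepmap alg (x, e))))%E.
Proof.
move=> [mg g0]; rewrite mean_law// /mean.
rewrite (fubini_tonelli1 (fun w => (g (stepmap alg w))%:E))//.
- apply/measurable_EFinP.
  exact: (measurableT_comp mg (measurable_stepmap alg)).
- by move=> w; rewrite lee_fin.
Qed.

Lemma measurable_mean_step (g : state d -> R) : nonneg_measurable g ->
  measurable_fun setT (fun x => mean Q (fun e => g (stepmap alg (x, e)))).
Proof.
move=> [mg g0].
apply: (measurable_fun_fubini_tonelli_F (fun w => (g (stepmap alg w))%:E)) => //.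
- apply/measurable_EFinP.
  exact: (measurableT_comp mg (measurable_stepmap alg)).
- by move=> w; rewrite lee_fin.
Qed.

Let coord i x : R := (x i)%:R.

Let nmx i : nonneg_measurable (coord i).
Proof. by apply: nonneg_measurable_nat; exact: measurable_coord. Qed.

Let nmpsi i : nonneg_measurable (fun x => psi x i : R).
Proof. by split=> [|x]; [exact: (measurable_psi (X := id))|exact: psi_ge0]. Qed.

Section invariant.
Variable mu : probability (state d) R.
Hypothesis inv : translation_invariant mu.

Lemma mean_coord i j : mean mu (coord i) = mean mu (coord j).
Proof.
rewrite -(mean_translate (i - j) inv (nmx j)); apply: mean_ext => x.
by rewrite /coord /translate addrC subrK.
Qed.

Lemma mean_psi i j : mean mu (fun x => psi x i) = mean mu (fun x => psi x j).
Proof.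
rewrite -(mean_translate (i - j) inv (nmpsi j)); apply: mean_ext => x.
by rewrite psi_shift addrC subrK.
Qed.

Lemma psi_mass x i : \sum_(j <- i :: nbrs i) coord j x * psi x i = coord i x.
Proof.
rewrite -mulr_suml /psi natr_sum /coord.
(* In an empty neighbourhood [psi] is [0 / 0 = 0], and the identity persists because [x_i = 0]. *)
have [S0|S0] := eqVneq (\sum_(j <- i :: nbrs i) (x j)%:R : R) 0.
  rewrite S0 mul0r; apply/esym/eqP; move: S0; rewrite big_cons => /eqP.
  by rewrite paddr_eq0 ?sumr_ge0// => /andP[].
by rewrite mulrCA divff ?mulr1.
Qed.

(* Mass transport: by translation invariance [x_i psi_j] may be replaced by
   [x_j psi_i] under the sum over the neighbours [j] of [i]. *)
Lemma mean_mass_transport i :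
  (\sum_(j <- nbrs i) mean mu (fun x => (coord i x * psi x j)%R) +
   mean mu (fun x => (coord i x * psi x i)%R) = mean mu (coord i))%E.
Proof.
have nmxp k l : nonneg_measurable (fun x => coord k x * psi x l).
  exact: nonneg_measurableM.
transitivity (\sum_(j <- nbrs i) mean mu (fun x => (coord j x * psi x i)%R) +
   mean mu (fun x => (coord i x * psi x i)%R))%E; last first.
  rewrite -mean_sum// -meanD//; last exact: nonneg_measurable_sum.
  by apply: mean_ext => x; rewrite -[RHS](psi_mass x i) big_cons addrC.
congr (_ + _)%E; rewrite /nbrs !big_map.
transitivity (\sum_(e <- unit_steps d) mean mu (fun x => (coord (i - e) x * psi x i)%R))%E.
  apply: eq_bigr => e _; rewrite -[RHS](mean_translate e inv (nmxp _ _)).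
  by apply: mean_ext => x; rewrite psi_shift /coord /translate subrK.
rewrite -(big_map (fun e => - e) xpredT (fun e => mean mu (fun x => (coord (i + e) x * psi
  x i)%R))).
apply: perm_big; apply: uniq_perm; rewrite ?uniq_unit_steps//.
  have oppI : injective (fun e : node d => - e) by move=> e f ef; rewrite -[e]opprK ef opprK.
  by rewrite (map_inj_uniq oppI) uniq_unit_steps.
move=> e; apply/mapP/idP => [[f fs ->]|es]; first by rewrite unit_stepsN.
by exists (- e); rewrite ?unit_stepsN ?opprK.
Qed.

Let c : R := (2 * d%:R + 1)^-1.

Let c_gt0 : 0 < c.
Proof. by rewrite invr_gt0 ltr_wpDl// mulr_ge0. Qed.

Let cE : c * (2 * d%:R + 1) = 1.
Proof. by rewrite mulVf// gt_eqF// -invr_gt0. Qed.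

(* The weighted form [2 c x <= x^2 / S + c^2 S] of Cauchy-Schwarz. *)
Lemma psi_lower_bound x i :
  2 * c * coord i x <=
  coord i x * psi x i + c ^+ 2 * \sum_(j <- i :: nbrs i) coord j x.
Proof.
rewrite -(psi_mass x i) -mulr_suml; set S := \sum_(j <- _) _.
have S0 : 0 <= S by rewrite sumr_ge0.
have := psi_ge0 (R := R) x i; set p := psi x i => p0.
have E (s t r : R) : s * t * t + r ^+ 2 * s - 2 * r * (s * t) = s * (t - r) ^+ 2.
  by ring.
by rewrite -subr_ge0 E mulr_ge0// sqr_ge0.
Qed.

Lemma mean_neighbourhood i :
  mean mu (fun x => \sum_(j <- i :: nbrs i) coord j x) =
  ((2 * d%:R + 1)%:E * mean mu (coord i))%E.
Proof.
rewrite mean_sum//; under eq_bigr do rewrite (mean_coord _ i).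
have m0 : (0 <= mean mu (coord i))%E by apply: mean_ge0 => x; exact: (nmx i).2.
have sumE (s : seq (node d)) : (\sum_(j <- s) mean mu (coord i) =
    (size s)%:R%:E * mean mu (coord i))%E.
  elim: s => [|j s IH]; first by rewrite big_nil mul0e.
  by rewrite big_cons IH /= -natr1 addrC EFinD ge0_muleDl ?lee_fin// mul1e.
by rewrite sumE /= size_nbrs -natr1 natrM.
Qed.

(** Here [h] is the mean of [psi_i]; services remove [h] jobs and routing returns [(1 - q) h],
    whence the net loss [q h]. In the factor of [h], [2d (1 - q)] comes from the squared inflow, [1]
    from the squared service indicator, and [- 2 a1 q] from the product of the arrivals with inflow
    minus service. *)
Lemma drift i (m2 : R) : mean mu (fun x => coord i x ^+ 2) = m2%:E ->
  exists m1 h : R, [/\ mean mu (coord i) = m1%:E, 0 <= m1, 0 <= h,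
    mean (transition alg Q mu) (coord i) = (m1 + a1 - q * h)%:E &
    (mean (transition alg Q mu) (fun x => coord i x ^+ 2)%R <=
     (m2 - 2 * (q * c - a1) * m1 + a2
      + (2 * d%:R * (1 - q) + 1 - 2 * a1 * q) * h)%:E)%E].
Proof.
move=> m2E.
have nmsq : nonneg_measurable (fun x => coord i x ^+ 2) by exact: nonneg_measurableM.
(* Every mean over the current state below is dominated by [1 + x_i^2], so it is a real number and
   may be subtracted. *)
have fin (f : state d -> R) : nonneg_measurable f -> (forall x, f x <= 1 + coord i x ^+ 2) ->
    mean mu f = (fine (mean mu f))%:E /\ 0 <= fine (mean mu f).
  move=> nf fle; split; last by rewrite fine_ge0// mean_ge0// => x; exact: nf.2.
  rewrite fineK// ge0_fin_numE ?mean_ge0//; last by move=> x; exact: nf.2.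
  have nm1 : nonneg_measurable (fun _ : state d => 1 : R) by exact: nonneg_measurable_cst.
  rewrite (le_lt_trans (mean_le mu nf (nonneg_measurableD nm1 nmsq) fle))//.
  by rewrite (meanD _ nm1 nmsq) mean_cst m2E ltry.
have xle x : coord i x <= coord i x ^+ 2 by rewrite -natrX ler_nat; case: (x i) => // n;
  rewrite leq_pmulr.
have [m1E m1_ge0] := fin _ (nmx i) (fun x => le_trans (xle x) (ler_wpDl ler01 (lexx _))).
set m1 := fine _ in m1E m1_ge0.
have psile x j : psi x j <= 1 + coord i x ^+ 2 :> R.
  by rewrite (le_trans (psi_le1 _ _))// lerDl exprn_ge0.
have [hE h_ge0] := fin _ (nmpsi i) (fun x => psile x i).
set h := fine _ in hE h_ge0.
have nmxp j : nonneg_measurable (fun x => coord i x * psi x j).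
  exact: nonneg_measurableM.
have xple x j : coord i x * psi x j <= 1 + coord i x ^+ 2 :> R.
  rewrite (le_trans (ler_piMr _ (psi_le1 _ _)))//.
  by rewrite (le_trans (xle x))// lerDr.
have [wE w_ge0] := fin _ (nmxp i) (fun x => xple x i).
set w := fine _ in wE w_ge0.
pose v j := fine (mean mu (fun x => (coord i x * psi x j)%R)).
have vE j : mean mu (fun x => (coord i x * psi x j)%R) = (v j)%:E.
  by have [] := fin _ (nmxp j) (fun x => xple x j).
have transport : \sum_(j <- nbrs i) v j + w = m1.
  apply/EFin_inj; rewrite EFinD -m1E -(mean_mass_transport i) -wE; congr (_ + _)%E.
  by rewrite -sumEFin; apply: eq_bigr => j _; rewrite vE.
(* Taking means in [psi_lower_bound] gives [2 c m1 <= w + c^2 (2d + 1) m1], and [c (2d + 1) = 1]. *)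
have w_ge : c * m1 <= w.
  have nS : nonneg_measurable (fun x => \sum_(j <- i :: nbrs i) coord j x).
    exact: nonneg_measurable_sum.
  have nl : nonneg_measurable (fun x => 2 * c * coord i x).
    by apply: nonneg_measurableM => //; apply: nonneg_measurable_cst; rewrite mulr_ge0// ltW.
  have nS' : nonneg_measurable (fun x => c ^+ 2 * \sum_(j <- i :: nbrs i) coord j x).
    by apply: nonneg_measurableM => //; apply: nonneg_measurable_cst; rewrite exprn_ge0// ltW.
  have := mean_le mu nl (nonneg_measurableD (nmxp i) nS') (fun x => psi_lower_bound x i).
  rewrite (meanD _ (nmxp i) nS') !meanZ ?exprn_ge0 ?mulr_ge0 ?(ltW c_gt0)//.
  rewrite mean_neighbourhood m1E wE -!EFinM -EFinD lee_fin mulrA expr2 -[c * c * _]mulrA cE.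
  by rewrite mulr1; lra.
pose kappa : R := (1 - q) / (2 * d%:R).
have d0 : 2 * d%:R != 0 :> R by rewrite mulf_neq0// pnatr_eq0 -lt0n.
have kappaE : 2 * d%:R * kappa = 1 - q by rewrite /kappa mulrC divfK.
have kappa_ge0 : 0 <= kappa by case/andP: q01 => _ q1; rewrite divr_ge0 ?subr_ge0 ?(ltW q1)//.
have a1_ge0 : 0 <= a1 by rewrite -lee_fin -mean1 mean_ge0.
have a2_ge0 : 0 <= a2 by rewrite -lee_fin -mean2 mean_ge0// => n; rewrite exprn_ge0.
pose p_in x : R := \sum_(j <- nbrs i) kappa * psi x j.
have nmp_in : nonneg_measurable p_in.
  by apply: nonneg_measurable_sum => j; apply: nonneg_measurableM => //; exact:
    nonneg_measurable_cst.
have p_inE : mean mu p_in = ((1 - q) * h)%:E.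
  rewrite mean_sum; last first.
    by move=> j; apply: nonneg_measurableM => //; exact: nonneg_measurable_cst.
  under eq_bigr do rewrite meanZ// (mean_psi _ i) hE -EFinM.
  rewrite sumEFin big_const_seq count_predT size_nbrs iter_addr_0.
  by rewrite -[_ *+ (2 * d)]mulr_natl natrM mulrA kappaE.
have xp_inE : mean mu (fun x => coord i x * p_in x) = (kappa * (m1 - w))%:E.
  rewrite (@mean_ext _ _ _ mu _ (fun x => \sum_(j <- nbrs i) kappa * (coord i x * psi x j))).
    rewrite mean_sum; last first.
      by move=> j; apply: nonneg_measurableM => //; exact: nonneg_measurable_cst.
    under eq_bigr do rewrite meanZ// vE -EFinM.
    by rewrite sumEFin -mulr_sumr -transport addrK.
  by move=> x; rewrite /p_in mulr_sumr; apply: eq_bigr => j _; rewrite mulrCA.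
have nmc (r : R) : 0 <= r -> nonneg_measurable (fun _ : state d => r).
  exact: nonneg_measurable_cst.
have nmZ (r : R) (f : state d -> R) : 0 <= r -> nonneg_measurable f ->
    nonneg_measurable (fun x => r * f x).
  by move=> r0 nf; apply: nonneg_measurableM => //; exact: nmc.
have D (f g : state d -> R) := @nonneg_measurableD R _ (state d) f g.
have cancel (A : \bar R) (r s : R) : (A + s%:E = r%:E -> A = (r - s)%:E)%E.
  by move=> As; rewrite EFinB -As addeK.
have Gge0 (g : state d -> R) x : (forall y, 0 <= g y) ->
    (0 <= mean Q (fun e => g (stepmap alg (x, e))))%E.
  by move=> g0; apply: mean_ge0.
exists m1, h; split => //.
- rewrite (_ : m1 + a1 - q * h = (m1 + a1 + (1 - q) * h) - h); last by ring.
  apply: cancel; rewrite mean_transition// -hE -ge0_integralD//; last 4 first.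
  + by move=> x _; apply: Gge0 => y.
  + exact: measurable_mean_step.
  + by move=> x _; rewrite lee_fin psi_ge0.
  + by apply/measurable_EFinP; exact: (nmpsi i).1.
  transitivity (mean mu (fun x => coord i x + a1 + p_in x)).
    by apply: eq_integral => x _; exact: (mean_step mean1 QL).
  rewrite (meanD _ (D _ _ (nmx i) (nmc _ a1_ge0)) nmp_in) (meanD _ (nmx i) (nmc _ a1_ge0)).
  by rewrite mean_cst m1E p_inE.
- have nl1 := nmZ 2 _ (ler0n _ _) (nmxp i).
  have nl2 := nmZ (2 * a1) _ (mulr_ge0 (ler0n _ _) a1_ge0) (nmpsi i).
  have nr1 := nmZ (2 * a1) _ (mulr_ge0 (ler0n _ _) a1_ge0) (nmx i).
  have nr2 := nmZ 2 _ (ler0n _ _) (nonneg_measurableM (nmx i) nmp_in).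
  have nr3 := nmZ (2 * d%:R) _ (mulr_ge0 (ler0n _ _) (ler0n _ _)) nmp_in.
  have nr4 := nmZ (2 * a1) _ (mulr_ge0 (ler0n _ _) a1_ge0) nmp_in.
  have main : (mean (transition alg Q mu) (fun x => coord i x ^+ 2)%R
      + (2 * w + 2 * a1 * h)%:E <=
      (m2 + 2 * a1 * m1 + 2 * (kappa * (m1 - w)) + a2 + 2 * d%:R * ((1 - q) * h)
       + h + 2 * a1 * ((1 - q) * h))%:E)%E.
    have nmH := measurable_mean_step nmsq.
    have nml := D _ _ nl1 nl2.
    have L : (2 * w + 2 * a1 * h)%:E =
        (\int[mu]_x (2 * (coord i x * psi x i) + 2 * a1 * psi x i)%:E)%E.
      rewrite -[RHS]/(mean mu _) (meanD _ nl1 nl2) !meanZ// ?mulr_ge0//.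
      by rewrite wE hE -!EFinM -EFinD.
    rewrite L mean_transition// -ge0_integralD//; last 3 first.
    + by move=> x _; exact: (Gge0 _ x nmsq.2).
    + by move=> x _; rewrite lee_fin; exact: nml.2.
    + by apply/measurable_EFinP; exact: nml.1.
    have nmr2 := D _ _ (D _ _ nmsq nr1) nr2.
    have nmr3 := D _ _ nmr2 (nmc _ a2_ge0).
    have nmr4 := D _ _ nmr3 nr3.
    have nmr5 := D _ _ nmr4 (nmpsi i).
    have nmr6 := D _ _ nmr5 nr4.
    apply: (@le_trans _ _ (mean mu (fun x => coord i x ^+ 2 + 2 * a1 * coord i x
      + 2 * (coord i x * p_in x) + a2 + 2 * d%:R * p_in x + psi x i
      + 2 * a1 * p_in x))); last first.
      rewrite (meanD _ nmr5 nr4) (meanD _ nmr4 (nmpsi i)) (meanD _ nmr3 nr3).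
      rewrite (meanD _ nmr2 (nmc _ a2_ge0)) (meanD _ (D _ _ nmsq nr1) nr2).
      rewrite (meanD _ nmsq nr1) mean_cst !meanZ ?mulr_ge0//; last first.
        exact: nonneg_measurableM.
      by rewrite m2E m1E xp_inE p_inE hE -!EFinM -!EFinD.
    apply: ge0_le_integral => //.
    + move=> x _; apply: adde_ge0; first by exact: (Gge0 _ x nmsq.2).
      by rewrite lee_fin; exact: nml.2.
    + by apply: emeasurable_funD => //; apply/measurable_EFinP; exact: nml.1.
    + by apply/measurable_EFinP; exact: nmr6.1.
    move=> x _.
    rewrite (_ : 2 * (coord i x * psi x i) + 2 * a1 * psi x i =
      2 * (x i)%:R * psi x i + 2 * (a1 * psi x i)); last by rewrite /coord; ring.
    apply: le_trans (mean_step_sqr mean1 mean2 QL alg x i) _.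
    rewrite lee_fin -/(p_in x) /coord le_eqVlt; apply/orP; left; apply/eqP.
    by ring.
  move: main; rewrite -leeBrDr// -EFinB => /le_trans; apply; rewrite lee_fin.
  (* Inflow and service contribute [2 (kappa (m1 - w) - w)]. By [k1], [w] may be replaced with
     [c m1]; since [1 - c = 2 d c], [k2] turns the result into [- 2 q c m1]. *)
  have k1 : 0 <= (kappa + 1) * (w - c * m1).
    by rewrite mulr_ge0 ?subr_ge0// addr_ge0.
  have k2 : (kappa - kappa * c) * m1 = (1 - q) * c * m1.
    rewrite -kappaE; congr (_ * _).
    have : kappa * (c * (2 * d%:R + 1)) = kappa by rewrite cE mulr1.
    by move: (c) => c' ?; lra.
  by move: k1 k2; move: (c) => c'; lra.
Qed.

End invariant.
End drift.

(** * Summing the drift along the chain started from the empty network *)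

Section chain.
Context {R : realType} {d : nat}.
Variables (law_xi : probability nat R) (q lambda a2 : R).
Hypothesis d_gt0 : (0 < d)%N.
Hypothesis q01 : 0 < q < 1.
Hypothesis mean1 : mean law_xi (fun n => n%:R) = (lambda * q)%:E.
Hypothesis mean2 : mean law_xi (fun n => n%:R ^+ 2) = a2%:E.
Hypothesis lambda_lt : lambda < 1 / (2 * d%:R + 1).
Variable Q : probability (slot R d) R.
Hypothesis QL : slot_law law_xi q Q.
Variable alg : algorithm.

Fixpoint chain (k : nat) : probability (state d) R :=
  if k is k'.+1 then transition alg Q (chain k') else dirac ((fun=> 0%N) : state d).

Lemma chain_invariant k : translation_invariant (chain k).
Proof.
elim: k => [|k IH]; last exact: (transition_translation_invariant d_gt0 QL alg IH).
by move=> v A mA.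
Qed.

Definition queue_bound : R :=
  (a2 + 2 * d%:R * (1 - q) * lambda + lambda - 2 * lambda ^+ 2 * q ^+ 2) /
  (2 * q * (1 / (2 * d%:R + 1) - lambda)).

Lemma chain_mean_sum i K :
  (\sum_(k < K) mean (chain k) (fun x => (x i)%:R) <= (K%:R * queue_bound)%:E)%E.
Proof.
have [q0 q1] := andP q01.
have lambda_ge0 : 0 <= lambda.
  by rewrite -(pmulr_lge0 _ q0) -lee_fin -mean1 mean_ge0.
set c := (2 * d%:R + 1)^-1 : R.
have cE : 1 / (2 * d%:R + 1) = c by rewrite div1r.
set kap := 2 * d%:R * (1 - q) + 1 - 2 * (lambda * q) * q.
(* [H] accumulates the mean service probabilities of node [i] and [M] its mean queue lengths, so
   that both moment recursions telescope. [H] is kept as it is until its bound is available. *)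
have inv : exists m1 m2 H M : R,
   [/\ mean (chain K) (fun x => (x i)%:R) = m1%:E,
       mean (chain K) (fun x => (x i)%:R ^+ 2) = m2%:E,
       (\sum_(k < K) mean (chain k) (fun x => (x i)%:R) = M%:E)%E,
       0 <= m1 /\ 0 <= m2 &
       m1 = K%:R * (lambda * q) - q * H /\
       m2 + 2 * (q * c - lambda * q) * M <= K%:R * a2 + kap * H].
  elim: K => [|K [m1 [m2 [H [M [m1E m2E ME [m10 m20] [mH drH]]]]]]].
    exists 0, 0, 0, 0; split => //.
    - rewrite /mean integral_dirac//=.
        by rewrite diracT mul1e.
      apply/measurable_EFinP; exact: (nonneg_measurable_nat (measurable_coord i)).1.
    - rewrite /mean integral_dirac//=.
        by rewrite diracT mul1e expr0n.
      have [mx _] := nonneg_measurable_nat (R := R) (measurable_coord i).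
      by apply/measurable_EFinP; exact: measurable_funX.
    - by rewrite big_ord0.
    - by rewrite !mul0r !mulr0 !subr0 addr0.
  have [m1' [h [m1E' _ h0 st st2]]] :=
    drift d_gt0 q01 mean1 mean2 QL alg (chain_invariant K) m2E.
  have m11 : m1' = m1 by apply/EFin_inj; rewrite -m1E -m1E'.
  move: st st2; rewrite m11 => st st2; set ES := mean (chain K.+1) (fun x => (x i)%:R ^+ 2 : R).
  have ES_ge0 : (0 <= ES)%E by apply: mean_ge0 => x; exact: exprn_ge0.
  have ESE : ES = (fine ES)%:E.
    by rewrite fineK// ge0_fin_numE// (le_lt_trans st2)// ltry.
  exists (m1 + lambda * q - q * h), (fine ES), (H + h), (M + m1); split => //.
  - by rewrite big_ord_recr /= ME m1E -EFinD.
  - by split; [rewrite -lee_fin -st; apply: mean_ge0|exact: fine_ge0].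
  split; first by rewrite mH -natr1; ring.
  have : fine ES <= m2 - 2 * (q * c - lambda * q) * m1 + a2 + kap * h.
    by rewrite -lee_fin -ESE.
  rewrite -natr1; move: drH; move: (fine ES) (c) (kap) => e c' k'; lra.
have [m1 [m2 [H [M [m1E m2E ME [m10 m20] [mH drH]]]]]] := inv.
rewrite ME lee_fin /queue_bound cE.
have cl : 0 < c - lambda by rewrite subr_gt0 -cE.
have cl2 : 0 < 2 * q * (c - lambda) by rewrite !mulr_gt0.
rewrite mulrA ler_pdivlMr//.
(* This is [0 <= m1] in the balance [m1 = K lambda q - q H]: mean departures cannot exceed mean
   arrivals. *)
have HK : H <= K%:R * lambda.
  by rewrite -(ler_pM2l q0); lra.
(* The upper bound on [H] is usable only if its coefficient is nonnegative. As [1 <= d], [lambda]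
   lies below [c <= 1/3], so the negative term [2 lambda q^2] is at most [2/3], less than the
   summand [1]. *)
have kap0 : 0 <= kap.
  have d1 : 1 <= d%:R :> R by rewrite ler1n.
  have c1 : c <= 3%:R^-1.
    by rewrite /c lef_pV2 ?posrE//; lra.
  have l1 : lambda * q <= 3%:R^-1.
    have l3 : lambda <= 3%:R^-1 by apply: le_trans c1; rewrite -subr_ge0 ltW.
    by rewrite -[leRHS]mulr1 ler_pM ?(ltW q0) ?(ltW q1).
  have l2 : lambda * q * q <= 3%:R^-1.
    by rewrite -[leRHS]mulr1 ler_pM ?mulr_ge0 ?(ltW q0) ?(ltW q1).
  have dq : 0 <= d%:R * (1 - q) by rewrite mulr_ge0// subr_ge0 ltW.
  by rewrite /kap; lra.
have kH : kap * H <= kap * (K%:R * lambda) by rewrite ler_wpM2l.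
apply: le_trans (_ : _ <= K%:R * a2 + kap * (K%:R * lambda)) _.
  by move: kH drH; move: (kap) (c) => k' c'; lra.
by rewrite /kap le_eqVlt; apply/orP; left; apply/eqP; ring.
Qed.

End chain.

(** * Time averages *)

Section time_average.
Context {R : realType} {dT} {T : measurableType dT}.
Variable mu : nat -> probability T R.

Lemma invn_ge0 (n : nat) : 0 <= n.+1%:R^-1 :> R.
Proof. by rewrite invr_ge0. Qed.

Definition time_average (n : nat) : set T -> \bar R :=
  mscale (NngNum (invn_ge0 n)) (msum (fun k => mu k : {measure set T -> \bar R}) n.+1).

HB.instance Definition _ n := Measure.on (time_average n).

Let time_average_setT n : time_average n setT = 1%E.
Proof.
rewrite /time_average /mscale /= /msum.
rewrite (eq_bigr (fun=> 1%E)); last by move=> k _; exact: probability_setT.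
by rewrite sumEFin sumr_const card_ord -EFinM -mulr_natl mulr1 mulVf.
Qed.

HB.instance Definition _ n := Measure_isProbability.Build _ _ _ (time_average n)
  (time_average_setT n).

Lemma time_averageE n A : time_average n A = (n.+1%:R^-1%:E * \sum_(k < n.+1) mu k A)%E.
Proof. by []. Qed.

Lemma mean_time_average n (g : T -> R) : nonneg_measurable g ->
  mean (time_average n) g = (n.+1%:R^-1%:E * \sum_(k < n.+1) mean (mu k) g)%E.
Proof.
move=> [mg g0]; rewrite /mean /time_average ge0_integral_mscale//; last 2 first.
- exact/measurable_EFinP.
- by move=> x _; rewrite lee_fin.
rewrite ge0_integral_measure_sum//.
- by move=> x _; rewrite lee_fin.
- exact/measurable_EFinP.
Qed.

End time_average.

Section time_average_transition.
Context {R : realType} {d : nat}.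
Variables (Q : probability (slot R d) R) (alg : algorithm).

Lemma transition_section (mu : probability (state d) R) A : measurable A ->
  transition alg Q mu A = (\int[Q]_e mu [set x | A (stepmap alg (x, e))])%E.
Proof.
move=> mA; rewrite -[LHS]/((mu \x Q)%E (stepmap alg @^-1` A)) product_prob_section//.
by rewrite -[X in measurable X]setTI; exact: measurable_stepmap.
Qed.

Lemma measurable_stepmap_section A : measurable A ->
  measurable (stepmap alg @^-1` A : set (state d * slot R d)).
Proof. by move=> mA; rewrite -[X in measurable X]setTI; exact: measurable_stepmap. Qed.

Lemma stepmap_ysection A (e : slot R d) : [set x | A (stepmap alg (x, e))] =
  ysection (stepmap alg @^-1` A : set (state d * slot R d)) e.
Proof. by apply/seteqP; split=> x; rewrite /ysection /= inE. Qed.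

Lemma measurable_fun_step_section (mu : probability (state d) R) A : measurable A ->
  measurable_fun setT (fun e : slot R d => mu [set x | A (stepmap alg (x, e))]).
Proof.
move=> mA; rewrite (_ : (fun _ => _) =
  (mu \o ysection (stepmap alg @^-1` A : set (state d * slot R d)))); last first.
  by apply/funext => e; rewrite /= -stepmap_ysection.
exact: (measurable_fun_ysection mu (measurable_stepmap_section mA)).
Qed.

(** One step shifts the averaging window by one slot, so only the two end terms differ. They are
    placed on opposite sides to avoid subtraction in the extended reals. *)
Lemma transition_time_average (mu : nat -> probability (state d) R) n A : measurable A ->
  (forall k, mu k.+1 = transition alg Q (mu k)) ->
  (transition alg Q (time_average mu n) A + n.+1%:R^-1%:E * mu 0%N A =
   time_average mu n A + n.+1%:R^-1%:E * mu n.+1 A)%E.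
Proof.
move=> mA muS.
have -> : transition alg Q (time_average mu n) A =
    (n.+1%:R^-1%:E * \sum_(k < n.+1) mu k.+1 A)%E.
  rewrite transition_section//.
  transitivity (\int[Q]_e (n.+1%:R^-1%:E *
    \sum_(k < n.+1) mu k [set x | A (stepmap alg (x, e))]))%E => //.
  rewrite ge0_integralZl//; last 2 first.
  - apply: emeasurable_sum => k; exact: measurable_fun_step_section.
  - by move=> e _; exact: sume_ge0.
  rewrite ge0_integral_sum//; last by move=> k; exact: measurable_fun_step_section.
  by congr (_ * _)%E; apply: eq_bigr => k _; rewrite muS transition_section.
rewrite time_averageE -!ge0_muleDr ?sume_ge0//; congr (_ * _)%E.
transitivity (\sum_(k < n.+2) mu k A)%E; last by rewrite big_ord_recr.
by rewrite [LHS]addeC [RHS]big_ord_recl.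
Qed.

End time_average_transition.

(** * Probabilities on sequences with prescribed cylinders *)

(* The point [u] of [[0, 1)] is sent to the sequence whose prefixes [s] are those
   with [u] in [[left_end s, left_end s + p s)]: these intervals are nested and
   the ones of the children of [s] subdivide the one of [s]. *)
Section tree.
Context {R : realType}.
Variable p : seq nat -> R.
Hypothesis p_nil : p [::] = 1.
Hypothesis p_ge0 : forall s, 0 <= p s.
Hypothesis p_sum : forall s : seq nat, \sum_(b < M) p (rcons s b) @[M --> \oo] --> p s.

Implicit Types (s : seq nat) (u : R).

Definition left_end (s : seq nat) : R :=
  \sum_(t < size s) \sum_(b < nth 0%N s t) p (rcons (take t s) b).

Lemma left_end_rcons s b :
  left_end (rcons s b) = left_end s + \sum_(b' < b) p (rcons s b').
Proof.
rewrite /left_end size_rcons big_ord_recr /= nth_rcons ltnn eqxx.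
rewrite -cats1 take_size_cat//; congr (_ + _); apply: eq_bigr => t _.
by rewrite nth_cat ltn_ord takel_cat// ltnW.
Qed.

Definition cell s (u : R) : bool := left_end s <= u < left_end s + p s.

Lemma partial_sum_le s M : \sum_(b < M) p (rcons s b) <= p s.
Proof.
have /cvg_lim <- // := @p_sum s; apply: (@nondecreasing_cvgn_le _ (fun M => \sum_(b < M) p
  (rcons s b))).
  apply/nondecreasing_seqP => n; by rewrite big_ord_recr /= lerDl.
by apply/cvg_ex; exists (p s); exact: p_sum.
Qed.

Lemma cell_rcons s b u : cell (rcons s b) u -> cell s u.
Proof.
rewrite /cell left_end_rcons => /andP[lu ul]; apply/andP; split.
  by apply: le_trans lu; rewrite lerDl sumr_ge0.
apply: lt_le_trans ul _; rewrite -addrA lerD2l.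
by have := partial_sum_le s b.+1; rewrite big_ord_recr.
Qed.

(** The masses of the children add up to [p s], so some finite partial sum passes [u]. The last
    child in the shortest such sum contains [u]. *)
Lemma cell_child s u : cell s u -> exists b, cell (rcons s b) u.
Proof.
rewrite /cell => /andP[lu ul].
have ex : exists M, u < left_end s + \sum_(b < M) p (rcons s b).
  have : \forall M \near \oo, u - left_end s < \sum_(b < M) p (rcons s b).
    by apply: (cvgr_gt _ (@p_sum s)); rewrite ltrBlDl.
  by case=> N _ /(_ N (leqnn N)); rewrite ltrBlDl => ?; exists N.
case: (ex_minnP ex) => -[|b] ub min_b.
  by move: ub; rewrite big_ord0 addr0 ltNge lu.
exists b; rewrite left_end_rcons -addrA; apply/andP; split; last first.
  by move: ub; rewrite big_ord_recr.
by rewrite leNgt; apply/negP => /min_b; rewrite ltnn.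
Qed.

Lemma cell_disjoint s b b' u : cell (rcons s b) u -> cell (rcons s b') u -> b = b'.
Proof.
have H k l : (k < l)%N -> cell (rcons s k) u -> cell (rcons s l) u -> False.
  move=> kl /andP[_ ku] /andP[lu _].
  move: (lt_le_trans (le_lt_trans lu ku) (lexx _)); rewrite !left_end_rcons -addrA.
  rewrite -[X in _ < _ + X](big_ord_recr k (fun b => p (rcons s b))) ltrD2l.
  rewrite ltNge -(subnKC kl) big_split_ord /= lerDl.
  by rewrite sumr_ge0.
by move=> cb cb'; case: (ltngtP b b') => // [/H|/H]; [move/(_ cb cb')|move/(_ cb' cb)].
Qed.

Definition child u s : nat := xget 0%N [set b | cell (rcons s b) u].

Fixpoint branch u (n : nat) : seq nat :=
  if n is n'.+1 then rcons (branch u n') (child u (branch u n')) else [::].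

Lemma cellP s u : 0 <= u < 1 -> cell s u <-> branch u (size s) = s.
Proof.
move=> u01; elim/last_ind: s => [|s b IH].
  by rewrite /cell /left_end big_ord0 p_nil add0r u01.
have childE : cell s u -> cell (rcons s (child u s)) u.
  by rewrite /child => /cell_child[b' cb']; case: xgetP => [k _ //|/(_ b')].
rewrite size_rcons /=; split=> [cb|/rcons_inj[Es Eb]].
  have cs := cell_rcons cb; rewrite (IH.1 cs); congr rcons.
  exact: (cell_disjoint (childE cs) cb).
have cs : cell s u by exact: IH.2.
by rewrite -Eb Es; exact: childE.
Qed.

(** Outside the half-open unit interval no child need exist; the value [0] there makes [digit] a
    total function, and only the point [1] of the closed unit interval is affected. *)
Definition digit (u : R) (m : nat) : nat :=
  if 0 <= u < 1 then child u (branch u m) else 0%N.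

Lemma mkseq_digit u n : 0 <= u < 1 -> mkseq (digit u) n = branch u n.
Proof.
move=> u01; elim: n => [//|n IH]; rewrite mkseqS IH /=.
by rewrite /digit u01.
Qed.

Lemma measurable_cell s : measurable [set u : R | cell s u].
Proof.
rewrite (_ : [set u | _] = `[left_end s, left_end s + p s[%classic)//.
Qed.

Lemma measurable_unit : measurable [set u : R | 0 <= u < 1].
Proof.
rewrite (_ : [set u | _] = `[0, 1[%classic)//.
Qed.

Lemma measurable_digit m : measurable_fun setT (fun u => digit u m).
Proof.
suff mb b : measurable [set u | digit u m = b].
  move=> _ B _; rewrite setTI.
  rewrite (_ : _ @^-1` B = \bigcup_(b in B) [set u | digit u m = b]).
    by apply: bigcup_measurable => b _; exact: mb.
  by apply/seteqP; split=> [u Bu|u [b Bb /= ub]]; [exists (digit u m)|rewrite /= ub].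
(* A digit equals [b] exactly when [u] lies in the cell of [rcons s b] for one of the countably many
   words [s] of length [m]. *)
pose S n : set R := if unpickle n is Some s then
  (if size s == m then [set u | cell (rcons s b) u] else set0) else set0.
have -> : [set u | digit u m = b] =
    ([set u | 0 <= u < 1] `&` \bigcup_n S n) `|`
    (~` [set u | 0 <= u < 1] `&` (if b == 0%N then setT else set0)).
  apply/seteqP; split=> u /=; rewrite /digit.
    case: ifPn => u01 ub; last by right; split; [exact/negP|rewrite -ub].
    left; split => //; exists (pickle (branch u m)) => //.
    have sb : size (branch u m) = m by rewrite -mkseq_digit// size_mkseq.
    rewrite /S pickleK sb eqxx /=; apply/(cellP _ u01).
    by rewrite size_rcons sb /= ub.
  move=> [[u01 [n _]]|[/negP/negbTE ->]]; last by case: eqP => // ->.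
  rewrite u01 /S; case: unpickle => // s; case: eqP => // sm /=.
  by move=> /(cellP _ u01); rewrite size_rcons /= sm => /rcons_inj[].
apply: measurableU; apply: measurableI.
- exact: measurable_unit.
- apply: bigcupT_measurable => n; rewrite /S; case: unpickle => // s.
  by case: eqP => // _; exact: measurable_cell.
- by apply: measurableC; exact: measurable_unit.
- by case: eqP.
Qed.

Lemma uniform_digit s :
  uniform_prob (@ltr01 R) [set u | mkseq (digit u) (size s) = s] = (p s)%:E.
Proof.
have mN : measurable (~` [set u : R | 0 <= u < 1]) by apply: measurableC; exact:
  measurable_unit.
have N0 : uniform_prob (@ltr01 R) (~` [set u : R | 0 <= u < 1]) = 0%E.
  rewrite uniform_probE// (_ : _ `&` _ = [set 1]) ?lebesgue_measure_set1//.
  apply/seteqP; split=> u /=; rewrite in_itv /=.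
    by move=> [/negP + /andP[u0 u1]]; rewrite u0 /= -leNgt => u1'; apply/le_anti/andP.
  by move=> ->; rewrite ler01 lexx ltxx andbF; split.
have mkm : measurable [set u | mkseq (digit u) (size s) = s].
  rewrite (_ : [set u | _] = \bigcap_(m in [set` iota 0 (size s)])
      [set u | digit u m = nth 0%N s m]).
    apply: fin_bigcap_measurable => // m _.
    by rewrite -[X in measurable X]setTI; exact: (@measurable_digit m measurableT [set nth
      0%N s m]).
  apply/seteqP; split=> u /=.
    by move=> us m /=; rewrite mem_iota /= add0n => ms; rewrite -[in RHS]us nth_mkseq.
  move=> us; apply: (@eq_from_nth _ 0%N); rewrite size_mkseq// => m ms.
  by rewrite nth_mkseq//; apply: us; rewrite /= mem_iota.
transitivity (uniform_prob (@ltr01 R) [set u | cell s u]).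
  apply: (@measure_eq_off_null _ _ _ (uniform_prob (@ltr01 R)) _ _ _ mkm
    (measurable_cell s) mN N0) => u /contrapT /= u01; rewrite mkseq_digit//; apply:
      iff_sym; exact: cellP.
rewrite [LHS]uniform_probE; last exact: measurable_cell.
have left0 : 0 <= left_end s by apply: sumr_ge0 => t _; exact: sumr_ge0.
(* Cells stay inside the unit interval, so the uniform law gives a cell its full length [p s]. *)
have left1 : left_end s + p s <= 1.
  elim/last_ind: (s) => [|t b IH]; first by rewrite /left_end big_ord0 p_nil add0r.
  apply: le_trans IH; rewrite left_end_rcons -addrA lerD2l.
  by have := partial_sum_le t b.+1; rewrite big_ord_recr.
rewrite (_ : _ `&` _ = `[left_end s, left_end s + p s[%classic).
  rewrite lebesgue_measure_itv /= lte_fin ltrDl.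
  have := p_ge0 s; rewrite le_eqVlt => /predU1P[<-|->]; first by rewrite ltxx.
  by rewrite -EFinB addrC addKr.
apply/seteqP; split=> u; rewrite /= !in_itv /= /cell; first by case.
move=> lu; split => //; case/andP: lu => lu ul.
by rewrite (le_trans left0 lu) (ltW (lt_le_trans ul left1)).
Qed.

End tree.

(** * Limits of tight sequences of laws *)

Section diagonal.
Import ArrowAsProduct.

(** By Tychonoff the rows have a cluster point [p] in a power of the unit interval. Choosing for
    each [k] a row beyond [k] that is within [1 / (k + 1)] of [p] on the first [k] coordinates gives
    [phi]; it need not be monotone, as only [k <= phi k] is used later. *)
Lemma diagonal_extraction {R : realType} (a : nat -> nat -> R) :
  (forall n j, 0 <= a n j <= 1) ->
  exists (p : nat -> R) (phi : nat -> nat), (forall k, (k <= phi k)%N) /\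
    forall j, a (phi k) j @[k --> \oo] --> p j.
Proof.
move=> a01.
have : compact [set f : nat -> R | forall j, `[0%R, 1%R]%classic (f j)].
  apply: (@tychonoff nat (fun=> R) (fun=> `[0%R, 1%R]%classic)) => j; exact: segment_compact.
move=> /(_ (a @ \oo) _); case.
  by exists 0%N => // n _ j; rewrite /= in_itv /=; exact: a01.
move=> p [_ clp].
have nearp k : exists n, (k <= n)%N /\ forall j, (j < k)%N -> `|a n j - p j| < k.+1%:R^-1.
  have B1 : nbhs p [set f : nat -> R | forall j, (j < k)%N -> `|f j - p j| < k.+1%:R^-1].
    have proj_near j : nbhs p [set f : nat -> R | `|f j - p j| < k.+1%:R^-1].
      have := @proj_continuous nat (fun=> R) j p.
      move=> /(_ [set y | `|y - p j| < k.+1%:R^-1]); apply.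
      apply/nbhs_ballP; exists k.+1%:R^-1 => //=.
      by move=> y /=; rewrite distrC.
    elim: {1}k => [|l IH].
      by apply: filterS filterT => f _ j.
    apply: filterS (filterI IH (proj_near l)) => f [/= fl fl'] j.
    by rewrite ltnS leq_eqVlt => /predU1P[->|/fl].
  have B2 : (a @ \oo) [set f | exists2 n, (k <= n)%N & f = a n].
    by exists k => // n /= kn; exists n.
  by have [f [[n kn ->] near_f]] := clp _ _ B2 B1; exists n.
have [phi phiP] := choice nearp.
exists p, phi; split=> [k|j]; first by case: (phiP k).
apply/cvgrPdist_lt => e e0; near=> k.
have [_ /(_ j)] := phiP k; rewrite distrC => /(_ _)/lt_trans; apply.
  by near: k; exact: nbhs_infty_gt.
by near: k; exact: (near_infty_natSinv_lt (PosNum e0)).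
Unshelve. all: by end_near. Qed.

End diagonal.

Section enumeration.
Variable d : nat.
Hypothesis d_gt0 : (0 < d)%N.

Lemma node_enumeration : exists (e : nat -> node d) (e' : node d -> nat),
  cancel e e' /\ cancel e' e.
Proof.
have inf : infinite_set [set: node d].
  (* Constant rows already give infinitely many nodes once there is a coordinate. *)
  pose f (n : nat) : node d := \row_(_ < d) n%:Z.
  have fI : injective f.
    move=> m n /matrixP/(_ 0 (Ordinal d_gt0)); rewrite !mxE.
    by move=> [].
  move=> fin; apply: infinite_nat.
  rewrite -(eq_finite_set (inj_card_eq (f := f) (A := setT) _)).
    exact: sub_finite_set fin.
  by move=> m n _ _; exact: fI.
have : ([set: node d] #= [set: nat])%card.
  by apply: eq_card_nat => //; exact: countableP.
move=> /pcard_eqP/bijPex [f [_ fi fs]].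
have fex n : exists x, f x = n by have [x _ <-] := fs n I; exists x.
have [g gK] := choice fex.
exists g, f; split => // x.
by apply: fi; rewrite ?inE.
Qed.

End enumeration.

Section compactness.
Context {R : realType} {d : nat}.
Implicit Types (x y : state d) (s : seq nat) (F : seq (node d)) (A : set (state d)).

Definition determined_by F A : Prop :=
  forall x y, (forall i, i \in F -> x i = y i) -> A x -> A y.

Lemma determined_byC F A : determined_by F A -> determined_by F (~` A).
Proof. by move=> FA x y xy Ax Ay; apply: Ax; apply: FA Ay => i iF; rewrite xy. Qed.

Variables (e : nat -> node d) (e' : node d -> nat).
Hypotheses (eK : cancel e e') (e'K : cancel e' e).

Definition prefix x N : seq nat := mkseq (fun m => x (e m)) N.

Definition cyl s : set (state d) := [set x | prefix x (size s) = s].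

Lemma prefix_eqP x y N : (prefix x N = prefix y N) <->
  (forall m, (m < N)%N -> x (e m) = y (e m)).
Proof.
split=> [h m mN|h].
  by have := congr1 (fun s => nth 0%N s m) h; rewrite !nth_mkseq.
by apply: (@eq_from_nth _ 0%N); rewrite !size_mkseq// => m mN; rewrite !nth_mkseq// h.
Qed.

Lemma measurable_cyl s : measurable (cyl s).
Proof.
rewrite (_ : cyl s = \bigcap_(m in [set` iota 0 (size s)])
    [set x : state d | x (e m) = nth 0%N s m]).
  apply: fin_bigcap_measurable => // m _.
  by rewrite -[X in measurable X]setTI;
    exact: (@measurable_coord d (e m) measurableT [set nth 0%N s m]).
apply/seteqP; split=> x; rewrite /cyl /prefix /=.
  by move=> xs m /=; rewrite mem_iota /= add0n => ms; rewrite -[in RHS]xs nth_mkseq.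
move=> xs; apply: (@eq_from_nth _ 0%N); rewrite size_mkseq// => m ms.
by rewrite nth_mkseq//; apply: xs; rewrite /= mem_iota.
Qed.

(** The event is cut into cylinders over the words of length [N] that it meets, indexed by their
    codes. [pickle_inv] is used because distinct valid codes then decode to distinct words, which
    keeps the pieces disjoint. *)
Definition pieces N A (j : nat) : set (state d) :=
  if pickle_inv (T := seq nat) j is Some s then
    if (size s == N) && `[< exists2 x, A x & prefix x N = s >] then cyl s else set0
  else set0.

Lemma pieces_cyl N A j : pieces N A j = set0 \/ exists s, pieces N A j = cyl s.
Proof.
rewrite /pieces; case: pickle_inv => [s|]; last by left.
by case: ifP => _; [right; exists s|left].
Qed.

Lemma measurable_pieces N A j : measurable (pieces N A j).
Proof. by have [->//|[s ->]] := pieces_cyl N A j; exact: measurable_cyl. Qed.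

Lemma trivIset_pieces N A : trivIset setT (pieces N A).
Proof.
move=> j k _ _ [x []]; rewrite /pieces.
case Ej: (pickle_inv j) => [s|//]; case: ifP => // /andP[/eqP sN _] xs.
case Ek: (pickle_inv k) => [t|//]; case: ifP => // /andP[/eqP tN _] xt.
have st : s = t by rewrite -xs -[in RHS]xt sN tN.
have := pickle_invK (T := seq nat) j; rewrite Ej /= => <-.
by have := pickle_invK (T := seq nat) k; rewrite Ek /= st.
Qed.

Lemma determined_pieces F A : determined_by F A -> exists N, A = \bigcup_j pieces N A j.
Proof.
move=> FA; pose N := (\max_(i <- F) (e' i).+1)%N.
exists N; apply/seteqP; split=> x.
  move=> Ax; exists (pickle (prefix x N)) => //.
  rewrite /pieces pickleK_inv size_mkseq eqxx /= ifT; first by rewrite /cyl /= size_mkseq.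
  by apply/asboolP; exists x.
move=> [j _]; rewrite /pieces; case: pickle_inv => // s.
case: ifP => // /andP[/eqP sN /asboolP [y Ay ys]] xs.
apply: FA Ay => i iF; rewrite -(e'K i).
have /prefix_eqP : prefix y N = prefix x N by rewrite ys -[in LHS]xs sN.
by apply; exact: (@leq_bigmax_seq _ F xpredT (fun i => (e' i).+1) i).
Qed.

Lemma measurable_determined F A : determined_by F A -> measurable A.
Proof.
move=> /determined_pieces[N ->]; apply: bigcupT_measurable => j.
exact: measurable_pieces.
Qed.

Lemma fine_le_add (m : probability (state d) R) A J (D : nat -> set (state d)) :
  (forall j, measurable (D j)) -> trivIset setT D -> measurable A ->
  (forall j, D j `<=` A) ->
  \sum_(j < J) fine (m (D j)) <= fine (m A).
Proof.
move=> mD tD mA DA.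
have mB : measurable (\big[setU/set0]_(j < J) D j) by exact: bigsetU_measurable.
have -> : \sum_(j < J) fine (m (D j)) = fine (m (\big[setU/set0]_(j < J) D j)).
  rewrite (measure_bigsetU m)// sum_fine// => j _; exact: fin_num_measure.
rewrite fine_le ?fin_num_measure// le_measure ?inE//.
by rewrite -bigcup_mkord => x [j _ /DA].
Qed.

(** An event that depends on finitely many nodes may be an infinite union of cylinders. Finitely
    many of them exhaust it up to [eps] under [pi], which bounds the limit from below; the same
    bound for the complement, with total mass one, gives the other side. *)
Lemma local_convergence (nu : nat -> probability (state d) R) (pi : probability (state d) R) :
  (forall s, fine (nu k (cyl s)) @[k --> \oo] --> fine (pi (cyl s))) ->
  forall F A, determined_by F A -> fine (nu k A) @[k --> \oo] --> fine (pi A).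
Proof.
move=> nu_pi F.
have lower A eps : determined_by F A -> 0 < eps ->
    \forall k \near \oo, fine (pi A) - eps < fine (nu k A).
  move=> FA eps0; have mA := measurable_determined FA.
  have [N AE] := determined_pieces FA.
  have cvg_pi : \sum_(j < J) fine (pi (pieces N A j)) @[J --> \oo] --> fine (pi A).
    have := @measure_sigma_additive _ _ _ pi _ (measurable_pieces N A) (@trivIset_pieces N A).
    rewrite -AE -[X in _ --> X]fineK ?fin_num_measure// => /fine_cvg.
    have -> : (fun J => \sum_(j < J) fine (pi (pieces N A j))) =
        fine \o (fun n => \sum_(0 <= j < n) pi (pieces N A j))%E.
      apply/funext => J /=; rewrite big_mkord sum_fine// => j _.
      by apply: fin_num_measure; exact: measurable_pieces.
    by [].
  have [J _ /(_ J (leqnn J)) piJ] : \forall J \near \oo,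
      fine (pi A) - eps < \sum_(j < J) fine (pi (pieces N A j)).
    by apply: (cvgr_gt _ cvg_pi); rewrite ltrBlDr ltrDl.
  have cvg_nu : \sum_(j < J) fine (nu k (pieces N A j)) @[k --> \oo] -->
      \sum_(j < J) fine (pi (pieces N A j)).
    elim: J {piJ} => [|J IH].
      by rewrite big_ord0; under eq_fun do rewrite big_ord0; exact: cvg_cst.
    rewrite big_ord_recr /=; under eq_fun do rewrite big_ord_recr /=.
    apply: cvgD => //; have [->|[s ->]] := pieces_cyl N A J; last exact: nu_pi.
    by rewrite measure0; under eq_fun do rewrite measure0; exact: cvg_cst.
  near=> k; apply: (lt_le_trans (y := \sum_(j < J) fine (nu k (pieces N A j)))).
    by near: k; exact: (cvgr_gt _ cvg_nu).
  apply: fine_le_add => //; first exact: measurable_pieces.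
    exact: trivIset_pieces.
  by move=> j x xj; rewrite AE; exists j.
move=> A FA; have mA := measurable_determined FA.
apply/cvgrPdist_lt => eps eps0.
have FC := determined_byC FA.
near=> k.
have h1 : fine (pi A) - eps < fine (nu k A) by near: k; exact: lower.
have h2 : fine (pi (~` A)) - eps < fine (nu k (~` A)) by near: k; exact: lower.
have compl (m : probability (state d) R) : fine (m (~` A)) = 1 - fine (m A).
  by rewrite probability_setC// fineB// fin_num_measure.
move: h2; rewrite !compl => h2.
by rewrite ltr_norml; lra.
Unshelve. all: by end_near. Qed.

Lemma cyl_rcons s b : cyl (rcons s b) = cyl s `&` [set x : state d | x (e (size s)) = b].
Proof.
apply/seteqP; split=> x; rewrite /cyl /prefix /= size_rcons mkseqS.
  by move=> /rcons_inj[].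
by move=> [-> ->].
Qed.

Lemma tight_limit (nu : nat -> probability (state d) R) (B : R) :
  (forall n i, (mean (nu n) (fun x => (x i)%:R) <= B%:E)%E) ->
  exists (pi : probability (state d) R) (phi : nat -> nat),
    (forall k, (k <= phi k)%N) /\
    forall s, fine (nu (phi k) (cyl s)) @[k --> \oo] --> fine (pi (cyl s)).
Proof.
move=> nuB.
pose a n j := fine (nu n (cyl (odflt [::] (unpickle j)))).
have a01 n j : 0 <= a n j <= 1.
  have mc := measurable_cyl (odflt [::] (unpickle j)).
  by rewrite fine_ge0//= -lee_fin fineK ?fin_num_measure// probability_le1.
have [p0 [phi [phi_ge a_cvg]]] := diagonal_extraction a01.
pose p s := p0 (pickle s).
have p_cvg s : fine (nu (phi k) (cyl s)) @[k --> \oo] --> p s.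
  by have := @a_cvg (pickle s); rewrite /a pickleK.
have p_nil : p [::] = 1.
  apply: (cvg_unique _ (@p_cvg [::])) => //.
  rewrite (_ : cyl [::] = setT); last by apply/seteqP; split.
  rewrite (_ : (fun k => fine (nu (phi k) setT)) = cst 1); first exact: cvg_cst.
  by apply/funext => k; rewrite /= [X in fine X]probability_setT.
have p_ge0 s : 0 <= p s.
  have c0 : (0 : R) @[k --> \oo] --> (0 : R) by exact: cvg_cst.
  by apply: (ler_cvg_to c0 (p_cvg s)); apply: nearW => k; exact: fine_ge0.
have mlt i M : measurable [set x : state d | (x i < M)%N].
  rewrite -[X in measurable X]setTI.
  exact: (@measurable_coord d i measurableT [set n | (n < M)%N]).
have sum_eq n s M : \sum_(b < M) fine (nu n (cyl (rcons s b))) =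
    fine (nu n (cyl s `&` [set x : state d | (x (e (size s)) < M)%N])).
  have mc := measurable_cyl.
  elim: M => [|M IH].
    rewrite big_ord0 (_ : _ `&` _ = set0) ?measure0//.
    by rewrite -subset0 => x [].
  rewrite big_ord_recr /= IH -fineD ?fin_num_measure//; last exact: measurableI.
  rewrite -measureU//; last 2 first.
  - exact: measurableI.
  - by rewrite cyl_rcons -subset0 => x [[_ /= xM] [_ /= xe]]; rewrite xe ltnn in xM.
  congr (fine (nu n _)); rewrite cyl_rcons -setIUr; congr (_ `&` _).
  apply/seteqP; split=> x /=; first by move=> [/leqW|->].
  by rewrite ltnS leq_eqVlt => /predU1P[|]; [right|left].
(* Markov's inequality at the node read after the word [s]: queue lengths above [M] carry mass at
   most [B / (M + 1)]. Uniformity in [n] allows [k] to tend to infinity before [M]. *)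
have lower n s M : fine (nu n (cyl s)) - B / M.+1%:R <=
    \sum_(b < M.+1) fine (nu n (cyl (rcons s b))).
  set i := e (size s); rewrite sum_eq -/i.
  pose G := [set x : state d | (M < x i)%N].
  have mG : measurable G.
    rewrite -[X in measurable X]setTI.
    exact: (@measurable_coord d i measurableT [set n | (M < n)%N]).
  have mcs := measurable_cyl s.
  have mI : measurable (cyl s `&` [set x : state d | (x i < M.+1)%N]) by exact: measurableI.
  have nuG : fine (nu n G) <= B / M.+1%:R.
    rewrite ler_pdivlMr// mulrC -lee_fin EFinM fineK ?fin_num_measure//.
    apply: le_trans (nuB n i); rewrite -(mean_indic (nu n) (b := fun x => (M < x i)%N))//.
    have nb : nonneg_measurable (fun x : state d => (M < x i)%N%:R : R).
      exact: (nonneg_measurable_nat (measurable_fun_nat (fun n => (M < n)%N : nat)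
        (measurable_coord i))).
    rewrite -meanZ//; apply: mean_le.
    - by apply: nonneg_measurableM => //; exact: nonneg_measurable_cst.
    - by apply: nonneg_measurable_nat; exact: measurable_coord.
    - move=> x; case: ltnP => [Mx|_]; first by rewrite mulr1 ler_nat.
      by rewrite mulr0.
  rewrite lerBlDr; apply: le_trans (lerD (lexx _) nuG).
  rewrite -fineD ?fin_num_measure// fine_le ?fin_numD ?fin_num_measure//.
  apply: le_trans (measureU2 _ mI mG); apply: le_measure; rewrite ?inE//.
    exact: measurableU.
  by move=> x cx; rewrite /G /=; case: (leqP (x i) M) => xM; [left|right].
have upper n s M : \sum_(b < M) fine (nu n (cyl (rcons s b))) <= fine (nu n (cyl s)).
  rewrite sum_eq fine_le ?fin_num_measure//; first exact: measurableI (measurable_cyl s) _.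
    exact: measurable_cyl.
  by apply: le_measure; rewrite ?inE; [apply: measurableI; first exact:
    measurable_cyl|exact: measurable_cyl|].
have p_sum s : \sum_(b < M) p (rcons s b) @[M --> \oo] --> p s.
  have sum_cvg M : \sum_(b < M) fine (nu (phi k) (cyl (rcons s b))) @[k --> \oo] -->
      \sum_(b < M) p (rcons s b).
    elim: M => [|M IH].
      by rewrite big_ord0; under eq_fun do rewrite big_ord0; exact: cvg_cst.
    rewrite big_ord_recr /=; under eq_fun do rewrite big_ord_recr /=.
    by apply: cvgD => //; exact: p_cvg.
  rewrite -cvg_shiftS; apply: (@squeeze_cvgr _ _ _ _ (fun M => p s - B * harmonic M) (fun=>
    p s)).
  - apply: nearW => M; apply/andP; split.
      apply: (ler_cvg_to (cvgB (@p_cvg s) (cvg_cst (B * harmonic M))) (sum_cvg M.+1)).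
      by apply: nearW => k; exact: lower.
    by apply: (ler_cvg_to (sum_cvg M.+1) (@p_cvg s)); apply: nearW => k; exact: upper.
  - rewrite -[X in _ --> X]subr0; apply: cvgB; first exact: cvg_cst.
    rewrite -[X in _ --> X](mulr0 B); apply: cvgM; first exact: cvg_cst.
    exact: cvg_harmonic.
  - exact: cvg_cst.
(* Node [i] receives the digit numbered [e' i], so that reading the nodes in the order of [e]
   returns the digits, and cylinders become prefix events. *)
have mF : measurable_fun setT (fun u : R => (fun i => digit p u (e' i)) : state d).
  by apply/measurable_stateP => i; exact: measurable_digit.
exists (law (uniform_prob (@ltr01 R)) mF), phi; split => // s.
have -> : fine (law (uniform_prob (@ltr01 R)) mF (cyl s)) = p s.
  rewrite -[RHS]/(fine (p s)%:E) -(uniform_digit p_nil p_ge0 p_sum).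
  have pE u : prefix (fun i => digit p u (e' i)) (size s) = mkseq (digit p u) (size s).
    by apply: eq_mkseq => m; rewrite eK.
  congr (fine (uniform_prob _ _)).
  by apply/seteqP; split=> u; rewrite /= /cyl /= pE.
exact: p_cvg.
Qed.

End compactness.

(** * The stationary law *)

Section locality.
Context {R : realType} {d : nat}.
Implicit Types (x y : state d) (F : seq (node d)) (A : set (state d)).

Hypothesis d_gt0 : (0 < d)%N.

Lemma determined_measurable F A : determined_by F A -> measurable A.
Proof.
have [e [e' [eK e'K]]] := node_enumeration d_gt0.
exact: (measurable_determined e'K).
Qed.

Lemma determined_unique (m1 m2 : probability (state d) R) :
  (forall F A, determined_by F A -> m1 A = m2 A) ->
  forall A, measurable A -> m1 A = m2 A.
Proof.
move=> m12 A mA.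
pose C := [set A : set (state d) | exists F, determined_by F A].
have cylC : cylinders (d := d) `<=` C.
  by move=> _ [i [n ->]]; exists [:: i] => x y xy /= <-; rewrite xy ?mem_head.
apply: (probability_unique (C := C)).
- by move=> D [F FD]; exact: determined_measurable FD.
- move=> D E [F FD] [G GE]; exists (F ++ G) => x y xy [Dx Ex]; split.
    by apply: FD Dx => i iF; apply: xy; rewrite mem_cat iF.
  by apply: GE Ex => i iG; apply: xy; rewrite mem_cat iG orbT.
- by exists [::].
- by move=> D [F FD]; exact: m12 FD.
- exact: (sub_sigma_algebra2 cylC).
Qed.

Definition neighbourhood F : seq (node d) := flatten [seq i :: nbrs i | i <- F].

Lemma mem_neighbourhood F i j : i \in F -> j \in i :: nbrs i -> j \in neighbourhood F.
Proof. by move=> iF ji; apply/flatten_mapP; exists i. Qed.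

Lemma eta_local alg x y (u : node d -> R) i : {in i :: nbrs i, x =1 y} ->
  eta alg x u i = eta alg y u i.
Proof.
move=> xy; have xyi : x i = y i by rewrite xy ?mem_head.
have tauE j : j \in i :: nbrs i -> tau x u j = tau y u j by move=> ji; rewrite /tau xy.
rewrite /eta xyi; congr (_ && _); case: alg.
  apply: eq_in_all => j ji; rewrite !tauE ?mem_head//.
  by rewrite inE ji orbT.
by rewrite /psi xyi; congr (_ < _ / _%:R); apply: eq_big_seq => j ji; rewrite xy.
Qed.

(** The new queue at a node involves the services at its neighbours, each decided by that
    neighbour's own neighbourhood; hence two enlargements. *)
Lemma stepmap_local alg F (e : slot R d) x y :
  {in neighbourhood (neighbourhood F), x =1 y} ->
  {in F, stepmap alg (x, e) =1 stepmap alg (y, e)}.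
Proof.
move=> xy i iF; rewrite /stepmap /step /=.
have etaE j : j \in i :: nbrs i -> eta alg x e.1.2 j = eta alg y e.1.2 j.
  move=> ji; apply: eta_local => k kj; apply: xy.
  by apply: mem_neighbourhood kj; exact: mem_neighbourhood ji.
have -> : x i = y i.
  apply: xy; apply: (mem_neighbourhood (i := i)); rewrite ?mem_head//.
  by apply: (mem_neighbourhood (i := i)); rewrite ?mem_head.
rewrite etaE ?mem_head//; congr (_ + _ - _)%N.
by apply: eq_big_seq => j ji; rewrite etaE// inE ji orbT.
Qed.

Lemma determined_stepmap alg F A (e : slot R d) : determined_by F A ->
  determined_by (neighbourhood (neighbourhood F)) [set x | A (stepmap alg (x, e))].
Proof. by move=> FA x y xy; apply: FA => i iF; exact: (stepmap_local alg e xy). Qed.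

Lemma determined_translate F A v : determined_by F A ->
  determined_by [seq i + v | i <- F] (translate v @^-1` A).
Proof. by move=> FA x y xy; apply: FA => i iF; apply: xy; exact: map_f. Qed.

End locality.

Section stationary_limit.
Context {R : realType} {d : nat}.
Variables (Q : probability (slot R d) R) (alg : algorithm).
Variables (nu : nat -> probability (state d) R) (pi : probability (state d) R).
Hypothesis d_gt0 : (0 < d)%N.
Hypothesis nu_pi : forall (F : seq (node d)) (A : set (state d)), determined_by F A ->
  fine (nu k A) @[k --> \oo] --> fine (pi A).

Lemma limit_transition :
  (forall k A, measurable A ->
    `|fine (transition alg Q (nu k) A) - fine (nu k A)| <= k.+1%:R^-1) ->
  forall A, measurable A -> transition alg Q pi A = pi A.
Proof.
move=> almost; apply: determined_unique => // F A FA.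
have mA := determined_measurable d_gt0 FA.
have dom : (transition alg Q (nu k) A @[k --> \oo] --> transition alg Q pi A)%E.
  rewrite transition_section//.
  rewrite (_ : (fun k => transition alg Q (nu k) A) =
    (fun k => \int[Q]_e nu k [set x | A (stepmap alg (x, e))])%E); last first.
    by apply/funext => k; rewrite transition_section.
  have mAe e := determined_measurable d_gt0 (@determined_stepmap R d alg F A e FA).
  apply: (@dominated_cvg _ _ _ Q setT measurableT _ _ (cst 1%E)) => //.
  - by move=> k; exact: measurable_fun_step_section.
  - move=> e _; rewrite -[X in _ --> X]fineK ?fin_num_measure//.
    apply/fine_cvgP; split; first by apply: nearW => k; exact: fin_num_measure.
    exact: nu_pi (@determined_stepmap R d alg F A e FA).
  - by apply/integrableP; split => //; rewrite integral_cst//= ?normr1 mul1e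
      (le_lt_trans (probability_le1 _ _)) ?ltry.
  - move=> k e _; rewrite gee0_abs ?measure_ge0//.
    exact: probability_le1.
have dom' : fine (transition alg Q (nu k) A) @[k --> \oo] --> fine (transition alg Q pi A).
  by apply: fine_cvg; rewrite fineK ?fin_num_measure.
(* The same differences also converge to the difference for [pi], so uniqueness of limits makes the
   latter zero. *)
have close : fine (transition alg Q (nu k) A) - fine (nu k A) @[k --> \oo] --> (0 : R).
  apply/cvgr0Pnorm_le => eps eps0; near=> k.
  apply: le_trans (almost k A mA) _; apply: ltW.
  by near: k; exact: (near_infty_natSinv_lt (PosNum eps0)).
have : fine (transition alg Q pi A) = fine (pi A).
  apply/eqP; rewrite -subr_eq0; apply/eqP.
  exact: (cvg_unique _ (cvgB dom' (nu_pi FA)) close).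
by move=> E; rewrite -[LHS]fineK ?fin_num_measure// -[RHS]fineK ?fin_num_measure// E.
Unshelve. all: by end_near. Qed.

Lemma limit_translation_invariant : (forall k, translation_invariant (nu k)) ->
  translation_invariant pi.
Proof.
move=> inv v A mA.
rewrite -[LHS](lawE pi (measurable_translate v)).
apply: determined_unique mA => // F {}A FA; have mA := determined_measurable d_gt0 FA.
have h := nu_pi (@determined_translate d F A v FA).
have E : fine (pi (translate v @^-1` A)) = fine (pi A).
  apply: (cvg_unique _ h) => //.
  rewrite (_ : (fun k => _) = (fun k => fine (nu k A))); first exact: nu_pi FA.
  by apply/funext => k; congr fine; exact: inv.
have mtA := determined_measurable d_gt0 (@determined_translate d F A v FA).
by rewrite -[RHS]fineK ?fin_num_measure// -E fineK ?fin_num_measure.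
Qed.

(** The queue length is unbounded, so convergence on local events does not reach its mean directly.
    Truncated at [M] it is the sum of the [M] indicators of [m < x_i], each a local event; the
    truncation is then removed by monotone convergence. *)
Lemma limit_mean_le i (B : R) : (forall k, (mean (nu k) (fun x => (x i)%:R) <= B%:E)%E) ->
  (mean pi (fun x => (x i)%:R) <= B%:E)%E.
Proof.
move=> nuB.
pose G m := [set x : state d | (m < x i)%N].
have Gdet m : determined_by [:: i] (G m).
  by move=> x y xy; rewrite /G /= xy ?mem_head.
have mG m : measurable (G m) := determined_measurable d_gt0 (Gdet m).
have tailE n M : \sum_(m < M) (m < n)%N%:R = (minn M n)%:R :> R.
  elim: M => [|M IH]; first by rewrite big_ord0 min0n.
  by rewrite big_ord_recr /= IH -natrD; congr _%:R; case: (ltnP M n) => /=; lia.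
have nmb m : nonneg_measurable (fun x : state d => (m < x i)%N%:R : R).
  exact: (nonneg_measurable_nat (measurable_fun_nat (fun n => (m < n)%N : nat)
    (measurable_coord i))).
have nmx : nonneg_measurable (fun x : state d => (x i)%:R : R).
  by apply: nonneg_measurable_nat; exact: measurable_coord.
have tail_mean (m : probability (state d) R) M :
    mean m (fun x => (minn M (x i))%:R) = (\sum_(j < M) fine (m (G j)))%:E.
  rewrite -sumEFin (@mean_ext _ _ _ m _ (fun x => \sum_(j < M) (j < x i)%N%:R)); last first.
    by move=> x; rewrite tailE.
  rewrite mean_sum//; apply: eq_bigr => j _.
  by rewrite fineK ?fin_num_measure//; exact: mean_indic (mG j).
have nmM M : nonneg_measurable (fun x : state d => (minn M (x i))%:R : R).
  exact: (nonneg_measurable_nat (measurable_fun_nat (minn M) (measurable_coord i))).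
have trunc M : (mean pi (fun x => (minn M (x i))%:R) <= B%:E)%E.
  rewrite tail_mean lee_fin.
  have sum_cvg : \sum_(j < M) fine (nu k (G j)) @[k --> \oo] --> \sum_(j < M) fine (pi (G j)).
    elim: M => [|M IH].
      by rewrite big_ord0; under eq_fun do rewrite big_ord0; exact: cvg_cst.
    rewrite big_ord_recr /=; under eq_fun do rewrite big_ord_recr /=.
    by apply: cvgD => //; exact: nu_pi (Gdet M).
  have B_cvg : B @[k --> \oo] --> B by exact: cvg_cst.
  apply: (ler_cvg_to sum_cvg B_cvg); apply: nearW => k.
  rewrite -lee_fin -tail_mean; apply: le_trans (nuB k); apply: mean_le => // x.
  by rewrite ler_nat geq_minr.
have mono : (mean pi (fun x => (minn M (x i))%:R) @[M --> \oo] -->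
    mean pi (fun x => (x i)%:R))%E.
  have limE x : limn (fun M => (minn M (x i))%:R%:E : \bar R) = (x i)%:R%:E.
    apply: cvg_lim => //; apply: cvg_near_cst; exists (x i) => // M /= xM.
    by rewrite (minn_idPr xM).
  rewrite (_ : mean pi (fun x => (x i)%:R) =
    \int[pi]_x limn (fun M => (minn M (x i))%:R%:E))%E; last first.
    by apply: eq_integral => x _; rewrite limE.
  apply: (@cvg_monotone_convergence _ _ _ pi setT measurableT
    (fun M x => (minn M (x i))%:R%:E)).
  - by move=> M; apply/measurable_EFinP; exact: (nmM M).1.
  - by move=> M x _; rewrite lee_fin.
  - by move=> x _ M N MN; rewrite lee_fin ler_nat leq_min geq_minr (leq_trans (geq_minl _ _)).
have := cvg_lim (@ereal_hausdorff R) mono => <-.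
apply: lime_le; first by apply/cvg_ex; exists (mean pi (fun x => (x i)%:R)); exact: mono.
exact: nearW.
Qed.

End stationary_limit.

(** * Applying the limit theorem to the time averages of the chain *)

Section existence.
Context {R : realType} {d : nat}.
Variables (law_xi : probability nat R) (q lambda a2 : R).
Hypothesis d_gt0 : (0 < d)%N.
Hypothesis q01 : 0 < q < 1.
Hypothesis mean1 : mean law_xi (fun n => n%:R) = (lambda * q)%:E.
Hypothesis mean2 : mean law_xi (fun n => n%:R ^+ 2) = a2%:E.
Hypothesis lambda_lt : lambda < 1 / (2 * d%:R + 1).
Variable Q : probability (slot R d) R.
Hypothesis QL : slot_law law_xi q Q.
Variable alg : algorithm.

Let nu n : probability (state d) R := time_average (chain Q alg) n.
Let bound : R := queue_bound (d := d) q lambda a2.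

Lemma time_average_mean_le n i : (mean (nu n) (fun x => (x i)%:R) <= bound%:E)%E.
Proof.
have nx : nonneg_measurable (fun x : state d => (x i)%:R : R).
  by apply: nonneg_measurable_nat; exact: measurable_coord.
rewrite (mean_time_average _ n nx).
have := chain_mean_sum d_gt0 q01 mean1 mean2 lambda_lt QL alg i n.+1.
move=> /(lee_wpmul2l (x := n.+1%:R^-1%:E)); rewrite lee_fin invr_ge0 ler0n => /(_ isT).
by rewrite -EFinM mulKf.
Qed.

Lemma time_average_invariant n : translation_invariant (nu n).
Proof.
move=> v A mA; apply: (congr1 (fun z => (n.+1%:R^-1%:E * z)%E)).
by apply: eq_bigr => k _; exact: (chain_invariant d_gt0 QL alg k v mA).
Qed.

Lemma time_average_almost_stationary n A : measurable A ->
  `|fine (transition alg Q (nu n) A) - fine (nu n A)| <= n.+1%:R^-1.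
Proof.
move=> mA; have E := transition_time_average n mA (fun k => erefl (chain Q alg k.+1)).
have cancel : fine (transition alg Q (nu n) A) + n.+1%:R^-1 * fine (chain Q alg 0 A) =
    fine (nu n A) + n.+1%:R^-1 * fine (chain Q alg n.+1 A).
  apply/EFin_inj; rewrite !EFinD !EFinM !fineK ?fin_num_measure//.
have le1 k : 0 <= fine (chain Q alg k A) <= 1.
  by rewrite fine_ge0//= -lee_fin fineK ?fin_num_measure// probability_le1.
have c0 : 0 <= n.+1%:R^-1 :> R by rewrite invr_ge0.
have dist_le1 (s t : R) : 0 <= s <= 1 -> 0 <= t <= 1 -> `|s - t| <= 1.
  by rewrite ler_norml; lra.
have -> : fine (transition alg Q (nu n) A) - fine (nu n A) =
    n.+1%:R^-1 * (fine (chain Q alg n.+1 A) - fine (chain Q alg 0 A)).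
  by apply/eqP; rewrite subr_eq mulrBr addrAC eq_sym subr_eq eq_sym cancel addrC.
by rewrite normrM ger0_norm// ler_piMr// dist_le1.
Qed.

Lemma invariant_law_exists : exists pi : probability (state d) R,
  [/\ forall A, measurable A -> transition alg Q pi A = pi A,
      translation_invariant pi &
      forall i, (mean pi (fun x => (x i)%:R) <= bound%:E)%E].
Proof.
have [e [e' [eK e'K]]] := node_enumeration d_gt0.
have [pi [phi [phi_ge cvg_cyl]]] := tight_limit eK time_average_mean_le.
have cvg_loc := local_convergence e'K cvg_cyl.
exists pi; split.
- apply: (limit_transition d_gt0 cvg_loc) => k A mA.
  apply: le_trans (time_average_almost_stationary _ mA) _.
  (* The average of index [phi k] is invariant up to [1 / (phi k + 1)], and [k <= phi k]. *)
  by rewrite lef_pV2 ?posrE ?ltr0n// ler_nat ltnS.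
- by apply: (limit_translation_invariant d_gt0 cvg_loc) => k; exact: time_average_invariant.
- by move=> i; apply: (limit_mean_le d_gt0 cvg_loc) => k; exact: time_average_mean_le.
Qed.

End existence.

Theorem theorem10 (R : realType) (d : nat) (hd : (1 <= d)%N)
    (q lambda : R) (hq : 0 < q < 1) (alg : algorithm)
    (law_xi : probability nat R)
    (hmean : ('E_law_xi[(fun n => n%:R)%R] = (lambda * q)%:E)%E)
    (hsquare : ('E_law_xi[(fun n => n%:R ^+ 2)%R] < +oo)%E)
    (dO : measure_display) (Omega : measurableType dO)
    (P : probability Omega R)
    (xi : nat -> node d -> {RV P >-> nat})
    (U : nat -> node d -> {RV P >-> R})
    (r : nat -> node d -> {RV P >-> destination d})
    (hdrivers : network_drivers xi U r law_xi q)
    (hlambda : lambda < 1 / (2 * d%:R + 1)) :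
  stable xi U r alg /\
  exists pi : probability (state d) R,
    [/\ stationary xi U r alg pi,
        translation_invariant pi &
        forall (i : node d) (k : nat),
          ('E_(pi \x P)[(fun w => (Xproc xi U r alg k w i)%:R)%R] <=
           ((fine 'E_law_xi[(fun n => n%:R ^+ 2)%R]%E
               + 2 * d%:R * (1 - q) * lambda + lambda
               - 2 * lambda ^+ 2 * q ^+ 2)
            / (2 * q * (1 / (2 * d%:R + 1) - lambda)))%:E)%E].
Proof.
have mean1 : mean law_xi (fun n => n%:R) = (lambda * q)%:E.
  by rewrite -hmean unlock.
have mean2 : mean law_xi (fun n => n%:R ^+ 2) =
    (fine 'E_law_xi[(fun n => n%:R ^+ 2)%R]%E)%:E.
  rewrite fineK; first by rewrite unlock.
  rewrite ge0_fin_numE//; rewrite unlock; apply: integral_ge0 => n _.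
  by rewrite lee_fin exprn_ge0.
have QL := slot_of_law hdrivers 0.
have [pi [pi_inv pi_tr pi_mean]] := invariant_law_exists hd hq mean1 mean2 hlambda QL alg.
have pi_st : stationary xi U r alg pi := transition_stationary hd hdrivers pi_inv.
split; first by exists pi.
exists pi; split => // i k.
have nx : nonneg_measurable (fun x : state d => (x i)%:R : R).
  by apply: nonneg_measurable_nat; exact: measurable_coord.
have E : 'E_(pi \x P)[(fun w => (Xproc xi U r alg k w i)%:R)%R]%E =
    mean (pi \x P)%E (fun w => (Xproc xi U r alg k w i)%:R) by rewrite unlock.
rewrite E -(mean_law _ (measurable_Xproc xi U r alg k) nx).
apply: le_trans (pi_mean i).
(* Stationarity holds in every slot, so the queues of slot [k] have law [pi] and inherit its mean
   bound. *)
by rewrite (mean_eq_measure _ (m2 := pi))// => A mA; exact: pi_st.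
Qed.
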